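(* An almost contact metric $5$-manifold $(M^5,g,\xi,\eta,\varphi)$ is of class $\mathcal W_4\oplus\mathcal W_7$ if and only if it is a generalized quasi-Sasaki manifold such that $N(\xi,X,Y)=2\,d\eta(X,Y)$ for all $X,Y$. Moreover, let $(M^5,g,\xi,\eta,\varphi)$ be any almost contact metric $5$-manifold of class $\mathcal W_4\oplus\mathcal W_7$, and let $\gamma$ be the $2$-form $\gamma(X,Y):=d\Phi(\xi,\varphi(X),Y)=N(\varphi(X),\varphi(Y),\xi)$. Then it is of class a) $\mathcal W_4$ if and only if $N$ is totally skew-symmetric, or equivalently if $\gamma=-2\,d\eta$. In this case, $N(X,Y,Z)=2(d\eta\wedge\eta)(X,Y,Z)$. b) $\mathcal W_7$ if and only if $N$ is traceless cyclic, or equivalently if $\gamma=d\eta$. In this case, $N(X,Y,Z)=2\,\eta(X)d\eta(Y,Z)+\eta(Y)d\eta(X,Z)-\eta(Z)d\eta(X,Y)$.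
   Context: An almost contact metric structure on a Riemannian $5$-manifold $(M^5,g)$ is a triple $(\xi,\eta,\varphi)$: a unit vector field $\xi$, its dual $1$-form $\eta$, and an endomorphism $\varphi$ of $TM^5$ with $\varphi(\xi)=0$, $\varphi^2=-\mathrm{Id}+\eta\otimes\xi$, $g(\varphi(X),\varphi(Y))=g(X,Y)-\eta(X)\eta(Y)$. Its fundamental form is $\Phi(X,Y):=g(X,\varphi(Y))$; locally there are oriented orthonormal (''adapted'') frames $(e_1,\dots,e_5)$ with $\Phi=e_1\wedge e_2+e_3\wedge e_4$, $\eta=e_5$ ($TM^5$ is identified with its dual via $g$), and these fix the orientation. $\nabla^g$ is the Levi-Civita connection, $d\alpha=\sum_i e_i\wedge\nabla^g_{e_i}\alpha$, so $d\eta(X,Y)=(\nabla^g_X\eta)(Y)-(\nabla^g_Y\eta)(X)$, and $(\beta\wedge\eta)(X,Y,Z)=\beta(X,Y)\eta(Z)+\beta(Y,Z)\eta(X)+\beta(Z,X)\eta(Y)$ for a $2$-form $\beta$. The Nijenhuis tensor is $$N(X,Y,Z):=g(X,[\varphi,\varphi](Y,Z))+\eta(X)\,d\eta(Y,Z),$$ $$[\varphi,\varphi](X,Y)=[\varphi(X),\varphi(Y)]+\varphi^2([X,Y])-\varphi([\varphi(X),Y])-\varphi([X,\varphi(Y)]).$$ $N$ is totally skew-symmetric if $N(X,Y,Z)+N(Y,X,Z)=0$; it is traceless cyclic if $N(X,Y,Z)+N(Y,Z,X)+N(Z,X,Y)=0$ and $\sum_iN(e_i,e_i,X)=0$. A generalized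 quasi-Sasaki manifold is an almost contact metric $5$-manifold such that (i) $N(X,Y,Z)=0$ and $d\Phi(X,Y,Z)=0$ for all $X,Y,Z$ orthogonal to $\xi$; (ii) $\xi$ is a Killing vector field for $g$. On a generalized quasi-Sasaki manifold the two expressions defining $\gamma$ agree and $\gamma$ is a $2$-form. Classes. Identify $\mathfrak{so}(5)$ with $\Lambda^2$. With $\ast$ the Hodge operator, $\Lambda^2=\Lambda^2_1\oplus\Lambda^2_2\oplus\Lambda^2_3\oplus\Lambda^2_4$, where $\Lambda^2_1=\{t\Phi\mid t\in\mathbb R\}$, $\Lambda^2_2=\{\beta\mid\Phi\wedge\beta=0,\ \ast\beta=\eta\wedge\beta\}$, $\Lambda^2_3=\{\beta\mid\ast\beta=-\eta\wedge\beta\}$, $\Lambda^2_4=\{\beta\mid\eta\wedge\beta=0\}$; then $\mathfrak u(2)=\Lambda^2_1\oplus\Lambda^2_3$ and $\mathfrak u(2)^\perp=\Lambda^2_2\oplus\Lambda^2_4$. With $\omega^g_{ij}=g(\nabla^ge_i,e_j)$ for an adapted frame and $\Omega^g=(\omega^g_{ij})$, the intrinsic torsion is $\Gamma(X):=\mathrm{pr}_{\mathfrak u(2)^\perp}(\Omega^g(X))$, a section of $\mathcal W:=\Lambda^1\otimes\mathfrak u(2)^\perp$, regarded as a $(3,0)$-tensor skew in its last two arguments. Let $\theta(\beta)(X,Y,Z):=\ast\beta(X,Y,Z)$ and $\vartheta(\beta)(X,Y,Z):=3\,\eta(X)\beta(Y,Z)-\ast\beta(X,Y,Z)$ for $\beta\in\Lambda^2$.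 Then $\mathcal W_4=\theta(\Lambda^2_2)\subset\mathcal W$ and $\mathcal W_7=\vartheta(\Lambda^2_2)\subset\mathcal W$. The manifold is of class $\mathcal W_4\oplus\mathcal W_7$ (resp. $\mathcal W_4$, $\mathcal W_7$) if $\Gamma$ takes values in that subspace at every point. *)

(* Defs.v *)
From mathcomp Require Export all_boot all_order all_algebra.
From mathcomp Require Export all_classical all_reals all_analysis.

Set Implicit Arguments.
Unset Strict Implicit.
Unset Printing Implicit Defensive.

Export Order.TTheory GRing.Theory Num.Theory numFieldNormedType.Exports.

Local Open Scope classical_set_scope.
Local Open Scope ring_scope.

(* For finite-dimensional V this is the usual class C^k on the open set U. *)
Fixpoint Ck (R : realType) (V W : normedModType R) (k : nat) (U : set V)
    (f : V -> W) : Prop :=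
  match k with
  | 0%N => forall x, U x -> {for x, continuous f}
  | k'.+1 => (forall x, U x -> differentiable f x) /\
             (forall v, Ck k' U (fun x => 'd f x v))
  end.

Definition smooth_on (R : realType) (V W : normedModType R) (U : set V)
    (f : V -> W) : Prop := forall k, Ck k U f.

Definition smooth_near (R : realType) (V W : normedModType R) (x : V)
    (f : V -> W) : Prop := exists U, [/\ open U, U x & smooth_on U f].

(* Charts are total functions; cmap is only meaningful on dom, and cinv on
   cmap @` dom. *)
Record chart (R : realType) (M : topologicalType) : Type := Chart {
  dom : set M;
  cmap : M -> 'rV[R]_5;
  cinv : 'rV[R]_5 -> M;
  dom_open : open dom;
  img_open : open (cmap @` dom);
  cmapK : forall p, dom p -> cinv (cmap p) = p;
  cmap_continuous : forall p, dom p -> {for p, continuous cmap};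
  cinv_continuous : forall x, (cmap @` dom) x -> {for x, continuous cinv}
}.

(* The choice of one chart of the atlas at every point serves to represent
   tangent vectors, see below. *)
Record manifold5 (R : realType) : Type := Manifold5 {
  carrier :> topologicalType;
  carrier_hausdorff : hausdorff_space carrier;
  carrier_second_countable : @second_countable carrier;
  atlas : set (chart R carrier);
  chart_at : carrier -> chart R carrier;
  chart_at_atlas : forall p, atlas (chart_at p);
  chart_at_dom : forall p, dom (chart_at p) p;
  atlas_smooth : forall c c', atlas c -> atlas c' ->
    smooth_on (cmap c @` (dom c `&` dom c')) (cmap c' \o cinv c)
}.

(* T_pM is R^5: a tangent vector at p is given by its components in
   chart_at p.  Vector fields are functions M -> R^5 and need only be smooth
   near the point under consideration. *)
Section Fields.
Variables (R : realType) (M : manifold5 R).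
Notation E := 'rV[R]_5.
Implicit Types (p q : M) (X Y : M -> E) (f : M -> R).

Definition point_at p : E := cmap (chart_at p) p.

(* The components in chart_at p of a tangent vector at q. *)
Definition change_chart p q (v : E) : E :=
  'd (cmap (chart_at p) \o cinv (chart_at q)) (point_at q) v.

(* The local expression of X in chart_at p. *)
Definition local_rep p X (x : E) : E :=
  let q := cinv (chart_at p) x in change_chart p q (X q).

Definition smooth_fun p f : Prop :=
  smooth_near (point_at p) (f \o cinv (chart_at p)).

Definition smooth_field p X : Prop := smooth_near (point_at p) (local_rep p X).

(* The derivative v(f) of f along the tangent vector v at p. *)
Definition deriv f p (v : E) : R :=
  'd (f \o cinv (chart_at p)) (point_at p) v.

Definition bracket X Y p : E :=
  'd (local_rep p Y) (point_at p) (X p) - 'd (local_rep p X) (point_at p) (Y p).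

Record metric : Type := Metric {
  gval :> M -> E -> E -> R;
  g_linear : forall p a u v w, gval p (a *: u + v) w = a * gval p u w + gval p v w;
  g_sym : forall p u v, gval p u v = gval p v u;
  g_pos : forall p u, u != 0 -> 0 < gval p u u;
  g_smooth : forall p X Y, smooth_field p X -> smooth_field p Y ->
    smooth_fun p (fun q => gval q (X q) (Y q))
}.

(* nabla p v Y is the derivative of Y at p along v. *)
Record levi_civita (g : metric) (nabla : M -> E -> (M -> E) -> E) : Prop :=
 LeviCivita {
  lc_linear : forall p a u v Y, smooth_field p Y ->
    nabla p (a *: u + v) Y = a *: nabla p u Y + nabla p v Y;
  lc_additive : forall p v Y Z, smooth_field p Y -> smooth_field p Z ->
    nabla p v (fun q => Y q + Z q) = nabla p v Y + nabla p v Z;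
  lc_leibniz : forall p v f Y, smooth_fun p f -> smooth_field p Y ->
    nabla p v (fun q => f q *: Y q) = deriv f p v *: Y p + f p *: nabla p v Y;
  lc_smooth : forall p X Y, smooth_field p X -> smooth_field p Y ->
    smooth_field p (fun q => nabla q (X q) Y);
  lc_metric : forall p v Y Z, smooth_field p Y -> smooth_field p Z ->
    deriv (fun q => g q (Y q) (Z q)) p v
    = g p (nabla p v Y) (Z p) + g p (Y p) (nabla p v Z);
  lc_torsion_free : forall p X Y, smooth_field p X -> smooth_field p Y ->
    nabla p (X p) Y - nabla p (Y p) X = bracket X Y p
}.

(* The 1-form eta is by definition dual to xi, hence not part of the data. *)
Record acm : Type := Acm {
  acm_g : metric;
  xi : M -> E;
  phi : M -> E -> E;
  xi_smooth : forall p, smooth_field p xi;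
  xi_unit : forall p, acm_g p (xi p) (xi p) = 1;
  phi_linear : forall p a u v, phi p (a *: u + v) = a *: phi p u + phi p v;
  phi_smooth : forall p X, smooth_field p X ->
    smooth_field p (fun q => phi q (X q));
  phi_xi : forall p, phi p (xi p) = 0;
  phi_sq : forall p u, phi p (phi p u) = - u + acm_g p (xi p) u *: xi p;
  phi_compat : forall p u v, acm_g p (phi p u) (phi p v)
    = acm_g p u v - acm_g p (xi p) u * acm_g p (xi p) v
}.

End Fields.

Arguments metric {R} M.
Arguments acm {R} M.

(* Forms are given by their components in the standard basis: 2-forms are skew
   matrices (this is also the identification of so(5) with 2-forms), 3-forms
   and (3,0)-tensors are functions of three indices.  The basis vectors
   e_1, ..., e_5 are numbered 0, ..., 4. *)
Section Model.
Variable R : realType.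
Notation I5 := 'I_5.
Notation tensor3 := (I5 -> I5 -> I5 -> R).
Implicit Types (b c : 'M[R]_5) (T : tensor3).

Definition basis_wedge (i j : I5) : 'M[R]_5 := delta_mx i j - delta_mx j i.

Definition Phi0 : 'M[R]_5 := basis_wedge 0 1 + basis_wedge 2 3.

Definition eta0 (i : I5) : R := (i == 4)%:R.

(* The volume form evaluated on basis vectors. *)
Definition vol5 (i j k l m : I5) : R :=
  \det (\matrix_(a < 5, c < 5) (tnth [tuple i; j; k; l; m] a == c)%:R).

Definition star2 b : tensor3 := fun k l m =>
  \sum_(i < 5) \sum_(j < 5 | (i < j)%N) b i j * vol5 i j k l m.

(* The wedge product of a 2-form and a 1-form, which commute. *)
Definition wedge21 b (a : I5 -> R) : tensor3 := fun i j k =>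
  b i j * a k + b j k * a i + b k i * a j.

Definition wedge22 b c (i j k l : I5) : R :=
  b i j * c k l - b i k * c j l + b i l * c j k
  + b j k * c i l - b j l * c i k + b k l * c i j.

Definition Lambda2 b : Prop := b^T = - b.

Definition Lambda2_1 b : Prop := exists t : R, b = t *: Phi0.

Definition Lambda2_2 b : Prop :=
  [/\ Lambda2 b, forall i j k l, wedge22 Phi0 b i j k l = 0
    & forall i j k, star2 b i j k = wedge21 b eta0 i j k].

Definition Lambda2_3 b : Prop :=
  Lambda2 b /\ forall i j k, star2 b i j k = - wedge21 b eta0 i j k.

Definition Lambda2_4 b : Prop :=
  Lambda2 b /\ forall i j k, wedge21 b eta0 i j k = 0.

Definition u2 b : Prop :=
  exists b1 b3, [/\ Lambda2_1 b1, Lambda2_3 b3 & b = b1 + b3].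

Definition u2perp b : Prop :=
  exists b2 b4, [/\ Lambda2_2 b2, Lambda2_4 b4 & b = b2 + b4].

(* The projection of b onto u2perp along u2: the unique c as below. *)
Definition pr_u2perp b : 'M[R]_5 :=
  xget 0 [set c | u2perp c /\ u2 (b - c)].

Definition theta b : tensor3 := star2 b.

Definition vartheta b : tensor3 := fun i j k =>
  3 * eta0 i * b j k - star2 b i j k.

Definition W4 T : Prop :=
  exists b, Lambda2_2 b /\ forall i j k, T i j k = theta b i j k.

Definition W7 T : Prop :=
  exists b, Lambda2_2 b /\ forall i j k, T i j k = vartheta b i j k.

Definition W4_plus_W7 T : Prop :=
  exists T4 T7, [/\ W4 T4, W7 T7 & forall i j k, T i j k = T4 i j k + T7 i j k].

End Model.

(* All tensors are evaluated at p on vector fields that are smooth near p.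
   deta and dPhi use the Levi-Civita connection nabla of the metric. *)
Section AlmostContactMetric.
Variables (R : realType) (M : manifold5 R) (A : acm M).
Notation E := 'rV[R]_5.
Variable nabla : M -> E -> (M -> E) -> E.
Implicit Types (p q : M) (X Y Z : M -> E).

Let g := acm_g A.

Definition eta p (u : E) : R := g p (xi A p) u.

Definition Phi p (u v : E) : R := g p u (phi A p v).

Definition phi_field X : M -> E := fun q => phi A q (X q).

Definition nabla_eta X Y p : R :=
  deriv (fun q => eta q (Y q)) p (X p) - eta p (nabla p (X p) Y).

Definition deta X Y p : R := nabla_eta X Y p - nabla_eta Y X p.

Definition nabla_Phi X Y Z p : R :=
  deriv (fun q => Phi q (Y q) (Z q)) p (X p)
  - Phi p (nabla p (X p) Y) (Z p) - Phi p (Y p) (nabla p (X p) Z).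

(* The value of \sum_i e_i /\ nabla_(e_i) Phi. *)
Definition dPhi X Y Z p : R :=
  nabla_Phi X Y Z p + nabla_Phi Y Z X p + nabla_Phi Z X Y p.

Definition phi_bracket X Y p : E :=
  bracket (phi_field X) (phi_field Y) p + phi A p (phi A p (bracket X Y p))
  - phi A p (bracket (phi_field X) Y p) - phi A p (bracket X (phi_field Y) p).

Definition Nij X Y Z p : R :=
  g p (X p) (phi_bracket Y Z p) + eta p (X p) * deta Y Z p.

(* On a generalized quasi-Sasaki manifold this is also
   Nij (phi_field X) (phi_field Y) xi. *)
Definition gamma X Y p : R := dPhi (xi A) (phi_field X) Y p.

Definition deta_wedge_eta X Y Z p : R :=
  deta X Y p * eta p (Z p) + deta Y Z p * eta p (X p) + deta Z X p * eta p (Y p).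

(* e is an adapted frame on some neighbourhood of p. *)
Definition adapted_frame p (e : 'I_5 -> M -> E) : Prop :=
  (forall i, smooth_field p (e i)) /\
  \forall q \near nbhs p, forall i j : 'I_5,
    [/\ g q (e i q) (e j q) = (i == j)%:R,
        Phi q (e i q) (e j q) = Phi0 R i j & eta q (e i q) = eta0 R i].

Definition connection_form p (e : 'I_5 -> M -> E) (v : E) : 'M[R]_5 :=
  \matrix_(i, j) g p (nabla p v (e i)) (e j p).

(* The components of the intrinsic torsion at p in the frame e. *)
Definition intrinsic_torsion p (e : 'I_5 -> M -> E) (k i j : 'I_5) : R :=
  pr_u2perp (connection_form p e (e k p)) i j.

(* As every W considered here is invariant under U(2), it does not matter which
   adapted frame is used at p. *)
Definition of_class (W : ('I_5 -> 'I_5 -> 'I_5 -> R) -> Prop) : Prop :=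
  forall p e, adapted_frame p e -> W (intrinsic_torsion p e).

Definition killing X : Prop :=
  forall p Y Z, smooth_field p Y -> smooth_field p Z ->
    deriv (fun q => g q (Y q) (Z q)) p (X p)
    = g p (bracket X Y p) (Z p) + g p (Y p) (bracket X Z p).

Definition generalized_quasi_Sasaki : Prop :=
  (forall p X Y Z,
     smooth_field p X -> smooth_field p Y -> smooth_field p Z ->
     g p (X p) (xi A p) = 0 -> g p (Y p) (xi A p) = 0 ->
     g p (Z p) (xi A p) = 0 ->
     Nij X Y Z p = 0 /\ dPhi X Y Z p = 0) /\
  killing (xi A).

Definition Nij_totally_skew : Prop :=
  forall p X Y Z,
    smooth_field p X -> smooth_field p Y -> smooth_field p Z ->
    Nij X Y Z p + Nij Y X Z p = 0.

Definition Nij_traceless_cyclic : Prop :=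
  (forall p X Y Z,
     smooth_field p X -> smooth_field p Y -> smooth_field p Z ->
     Nij X Y Z p + Nij Y Z X p + Nij Z X Y p = 0) /\
  (forall p e X, adapted_frame p e -> smooth_field p X ->
     \sum_(i < 5) Nij (e i) (e i) X p = 0).

End AlmostContactMetric.

(* Main.v *)
(* In an adapted frame nabla Phi = [Phi0, omega] and nabla xi are linear in the intrinsic
   torsion Gamma, and so are d eta, d Phi and N.  Gamma lies in W4 + W7 exactly if its only
   components are a form C in Lambda2_2 with Gamma(e_k)(e_i, xi) = C(e_k, e_i) and a form B in
   Lambda2_2 with Gamma(xi) = B on the complement of xi; W4 is B = C and W7 is B = - 2 C.  In
   these terms d eta = - 2 C, gamma = 2 (B + C), N(xi, ., .) = - 4 C and
   N(., ., xi) = - 2 (B + C), from which all the equivalences are read off.  The existence of an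
   adapted frame near every point comes from the Gram-Schmidt process. *)
From HB Require Import structures.
From mathcomp Require Import ring lra.
Require Import Defs.
Set Implicit Arguments.
Unset Strict Implicit.
Unset Printing Implicit Defensive.
Local Open Scope ring_scope.

(** * Calculus of C^k maps *)

Section Differential.
Local Open Scope classical_set_scope.
Context {R : realType} {V W : normedModType R}.

(** The connection [nabla] is known only through its axioms on smooth fields, and dependence on the
    germ of a field is not one of them. A frame can therefore be inserted into a tensor only after
    the tensor has been shown to depend on the values of its arguments at [p]. For nabla eta this is
    metric compatibility. For nabla Phi it is metric compatibility in one slot, and skewness carries
    it to the other. Torsion-freeness then rewrites N and the Killing equation through these two.
    What remains is algebra in the entries of the five skew matrices omega(e_k), where [ring] and
    [lra] decide every identity. To that end the Hodge operator is made polynomial in the indices by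
    a Vandermonde determinant, and the projection onto u(2)^perp is made explicit. *)

Lemma near_eq_differentiable (f g : V -> W) x :
  (\forall y \near x, f y = g y) -> differentiable f x -> differentiable g x.
Proof.
move=> fg /diff_locallyP [cdf fE]; apply/diff_locallyP.
suff h : g \o shift x = cst (g x) + 'd f x +o_ 0 id.
  by rewrite (diff_unique cdf h).
apply/eqaddoP => e e0.
move/eqaddoP/(_ e e0): fE => fE.
have fg0 : \forall y \near 0, f (y + x) = g (y + x).
  by move: fg; rewrite (near_shift 0 x) subr0.
near=> y.
rewrite /= !fctE -(near fg0 y)//= -(nbhs_singleton fg).
by near: y.
Unshelve. all: by end_near. Qed.

Lemma near_eq_diff (f g : V -> W) x v : differentiable f x ->
  (\forall y \near x, f y = g y) -> 'd f x v = 'd g x v.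
Proof.
move=> df fg; have dg := near_eq_differentiable fg df.
by rewrite -!deriveE//; exact: near_eq_derive.
Qed.

Lemma diff_near_cst (f : V -> W) x v a :
  (\forall y \near x, f y = a) -> 'd f x v = 0.
Proof.
move=> fa; rewrite -(near_eq_diff (f := cst a))//.
  by rewrite diff_cst.
by near do apply/esym.
Unshelve. all: by end_near. Qed.

End Differential.

(** Scaling is a continuous bilinear map on [R * W]; the chain rule along [y |-> (k y, f y)] then
    gives the product rule. *)
Lemma is_diff_scale (R : realType) (V W : normedModType R)
  (k dk : V -> R) (f df : V -> W) x :
  is_diff x k dk -> is_diff x f df ->
  is_diff x (fun y => k y *: f y) (fun y => k x *: df y + dk y *: f x).
Proof.
move=> dkx dfx.
have bil : bilinear_for (GRing.Scale.Law.clone _ _ *:%R _)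
    (GRing.Scale.Law.clone _ _ *:%R _) ( *:%R : R -> W -> W).
  split=> [u'|u] a x0 y /=; first by rewrite scalerDl scalerA.
  by rewrite scalerDr !scalerA mulrC.
pose bM := bilinear_isBilinear.Build R R W W _ _ _ bil.
pose b : {bilinear R -> W -> W} := HB.pack ( *:%R : R -> W -> W) bM.
have bc : continuous (fun p : R * W => b p.1 p.2) by exact: scale_continuous.
have d2 : is_diff (k x, f x) (fun p : R * W => b p.1 p.2)
   (fun q => b (k x) q.2 + b q.1 (f x)).
  by apply: DiffDef; [exact: differentiable_bilin|rewrite diff_bilin].
exact: (@is_diff_comp _ _ _ _ (fun y => (k y, f y)) _ _ _ x _ d2).
Qed.

Section Ck.
Local Open Scope classical_set_scope.
Context {R : realType} {V : normedModType R}.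
Implicit Types (U : set V) (k : nat).

(** Openness turns agreement on [U] into agreement near each point of [U], which is what
    differentials see. The closure lemmas below use it to replace a directional derivative by an
    explicit formula. *)
Lemma Ck_ext (W : normedModType R) k U (f g : V -> W) : open U ->
  (forall x, U x -> f x = g x) -> Ck k U f -> Ck k U g.
Proof.
move=> oU; elim: k f g => [|k IH] f g fg /=.
  move=> fc x Ux; have := fc x Ux.
  change (f @ x --> f x -> g @ x --> g x); rewrite -(fg x Ux).
  apply: cvg_trans; apply: near_eq_cvg.
  by apply: filterS (open_nbhs_nbhs (conj oU Ux)) => y Uy; rewrite fg.
have nfg x : U x -> (\forall y \near x, f y = g y).
  by move=> Ux; apply: filterS (open_nbhs_nbhs (conj oU Ux)) => y; exact: fg.
case=> [df dfC]; split=> [x Ux|v]; first exact: near_eq_differentiable (nfg x Ux) (df x Ux).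
apply: (IH (fun x => 'd f x v)) => // x Ux.
by apply: near_eq_diff; [exact: df|exact: nfg].
Qed.

Lemma CkS (W : normedModType R) k U (f : V -> W) : Ck k.+1 U f -> Ck k U f.
Proof.
elim: k f => [|k IH] f /=.
  by case=> df _ x Ux; exact/differentiable_continuous/df.
by case=> df dfC; split=> // v; apply: IH; exact: dfC.
Qed.

Lemma Ck_cst (W : normedModType R) k U (a : W) : Ck k U (cst a : V -> W).
Proof.
elim: k a => [|k IH] a /=; first by move=> x _; exact: cst_continuous.
split=> [x _|v]; first exact: differentiable_cst.
rewrite (_ : (fun _ => _) = cst 0); first exact: IH.
by apply/funext => x; rewrite diff_cst.
Qed.

Lemma CkD (W : normedModType R) k U (f g : V -> W) : open U ->
  Ck k U f -> Ck k U g -> Ck k U (fun x => f x + g x).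
Proof.
move=> oU; elim: k f g => [|k IH] f g.
  by move=> fc gc x Ux; apply: continuousD; [exact: fc|exact: gc].
move=> [df fC] [dg gC]; split=> [x Ux|v].
  by apply: differentiableD; [exact: df|exact: dg].
apply: (Ck_ext oU _ (IH _ _ (fC v) (gC v))) => x Ux.
by rewrite (_ : (fun x => f x + g x) = f + g)// diffD//; [exact: df|exact: dg].
Qed.

Lemma CkZ (W : normedModType R) k U (h : V -> R) (f : V -> W) : open U ->
  Ck k U h -> Ck k U f -> Ck k U (fun x => h x *: f x).
Proof.
move=> oU; elim: k h f => [|k IH] h f hC fC.
  by move=> x Ux; apply: continuousZ; [exact: hC|exact: fC].
(* Each term of the product rule keeps one factor undifferentiated, so both factors are also needed
   at level [k]. *)
have hk := CkS hC; have fk := CkS fC.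
case: hC fC => [dh hC] [df fC].
have D x : U x -> is_diff x (fun y => h y *: f y) (fun y => h x *: 'd f x y + 'd h x y *: f x).
  by move=> Ux; apply: is_diff_scale; apply: differentiableP; [exact: dh|exact: df].
split=> [x Ux|v]; first by case: (D x Ux).
apply: (Ck_ext oU _ (CkD oU (IH _ _ hk (fC v)) (IH _ _ (hC v) fk))) => x Ux.
by case: (D x Ux) => _ ->.
Qed.

(** The function r(y) = y^(-1/2) satisfies r' = - r^3 / 2, so the derivative of r o f is a product
    of copies of r o f and the derivative of f, and the induction closes. *)
Lemma Ck_invsqrt k U (f : V -> R) : open U -> (forall x, U x -> 0 < f x) ->
  Ck k U f -> Ck k U (fun x => (Num.sqrt (f x))^-1).
Proof.
move=> oU f0; elim: k f f0 => [|k IH] f f0 fC.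
  move=> x Ux.
  apply: (@continuous_comp _ _ _ f (fun y => (Num.sqrt y)^-1)); first exact: fC.
  apply: continuousV; first by rewrite gt_eqF// sqrtr_gt0 f0.
  exact: sqrt_continuous.
have rk := IH _ f0 (CkS fC); case: fC => df fC.
pose r y : R := (Num.sqrt y)^-1.
have D x : U x -> is_diff x (r \o f)
    (fun v => - 2^-1 * r (f x) * r (f x) * r (f x) * 'd f x v).
  move=> Ux; have fx0 := f0 x Ux.
  have s0 : Num.sqrt (f x) != 0 by rewrite gt_eqF// sqrtr_gt0.
  have h := is_derive1_sqrt fx0.
  have dr : is_derive (f x) 1 r (- (Num.sqrt (f x)) ^- 2 * (2 * Num.sqrt (f x))^-1).
    exact: is_deriveV.
  have dr' : differentiable r (f x) by apply/derivable1_diffP; case: dr.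
  apply: DiffDef; first by apply: differentiable_comp => //; exact: df.
  rewrite diff_comp//; last exact: df.
  apply/funext => v /=.
  rewrite -[X in 'd r _ X]mulr1 linearZ /= -(deriveE _ dr').
  case: dr => _ ->; rewrite /r /= /GRing.scale /=; field.
  exact: s0.
split=> [x Ux|v]; first by case: (D x Ux).
have h : Ck k U (fun x => (- 2^-1) *: (r (f x) *: (r (f x) *: (r (f x) *: 'd f x v)))).
  apply: CkZ => //; first exact: Ck_cst.
  by do 3![apply: CkZ => //]; exact: fC.
apply: (Ck_ext oU _ h) => x Ux.
by case: (D x Ux) => _ ->; rewrite /= /GRing.scale /= !mulrA.
Qed.

End Ck.

Section SmoothNear.
Local Open Scope classical_set_scope.
Context {R : realType} {V : normedModType R}.

Lemma Ck_sub (W : normedModType R) k (A B : set V) (f : V -> W) :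
  A `<=` B -> Ck k B f -> Ck k A f.
Proof.
move=> AB; elim: k f => [|k IH] f /=; first by move=> fc x /AB /fc.
by case=> df fC; split=> [x /AB /df//|v]; exact/IH/fC.
Qed.

Variable x : V.

Lemma smooth_near_differentiable (W : normedModType R) (f : V -> W) :
  smooth_near x f -> differentiable f x.
Proof. by case=> U [_ Ux /(_ 1%N)[df _]]; exact: df. Qed.

Lemma smooth_near_continuous (W : normedModType R) (f : V -> W) :
  smooth_near x f -> {for x, continuous f}.
Proof. by move/smooth_near_differentiable/differentiable_continuous. Qed.

Lemma smooth_near_cst (W : normedModType R) (f : V -> W) a :
  (\forall y \near x, f y = a) -> smooth_near x f.
Proof.
move=> fa; exists [set y | f y = a]°; split => [||k].
- exact: open_interior.
- exact: fa.
- apply: (Ck_ext _ _ (Ck_cst _ _ a)); first exact: open_interior.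
  by move=> y /interior_subset.
Qed.

Lemma smooth_nearD (W : normedModType R) (f g : V -> W) :
  smooth_near x f -> smooth_near x g -> smooth_near x (fun y => f y + g y).
Proof.
case=> A [oA Ax fC] [B [oB Bx gC]]; exists (A `&` B); split => //.
  exact: openI.
move=> k; apply: CkD; first exact: openI.
  by apply: Ck_sub (fC k); exact: subIsetl.
by apply: Ck_sub (gC k); exact: subIsetr.
Qed.

Lemma smooth_nearZ (W : normedModType R) (h : V -> R) (f : V -> W) :
  smooth_near x h -> smooth_near x f -> smooth_near x (fun y => h y *: f y).
Proof.
case=> A [oA Ax fC] [B [oB Bx gC]]; exists (A `&` B); split => //.
  exact: openI.
move=> k; apply: CkZ; first exact: openI.
  by apply: Ck_sub (fC k); exact: subIsetl.
by apply: Ck_sub (gC k); exact: subIsetr.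
Qed.

Lemma smooth_near_gt0 (f : V -> R) : smooth_near x f -> 0 < f x ->
  \forall y \near x, 0 < f y.
Proof.
move=> /smooth_near_continuous fc f0.
exact: (fc _ (lt_nbhsr f0)).
Qed.

Lemma smooth_near_invsqrt (f : V -> R) : smooth_near x f -> 0 < f x ->
  smooth_near x (fun y => (Num.sqrt (f y))^-1).
Proof.
move=> fs f0; have fx := smooth_near_gt0 fs f0.
case: fs => A [oA Ax fC]; exists (A `&` [set y | 0 < f y]°).
have oU : open (A `&` [set y | 0 < f y]°) by apply: openI => //; exact: open_interior.
split => // k; apply: Ck_invsqrt => //.
  by move=> y [_ /interior_subset].
by apply: Ck_sub (fC k); exact: subIsetl.
Qed.

End SmoothNear.

(** * Smooth functions and fields on the manifold *)

Section Charts.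
Local Open Scope classical_set_scope.
Context {R : realType} (M : manifold5 R).
Notation E := 'rV[R]_5.
Implicit Types (p q : M).

Lemma cinv_point_at p : cinv (chart_at p) (point_at p) = p.
Proof. exact/cmapK/chart_at_dom. Qed.

Lemma near_cinv p (P : set M) :
  nbhs p P -> \forall x \near point_at p, P (cinv (chart_at p) x).
Proof.
move=> nP; have := @cinv_continuous _ _ (chart_at p) (point_at p).
rewrite /prop_for /= /continuous_at cinv_point_at.
by apply => //; exists p => //; exact: chart_at_dom.
Qed.

Lemma near_cmap p (P : set E) :
  nbhs (point_at p) P -> \forall q \near p, P (cmap (chart_at p) q).
Proof. by move=> nP; exact: (cmap_continuous (chart_at_dom p) nP). Qed.

Lemma near_dom p : \forall q \near p, dom (chart_at p) q.
Proof. by apply: open_nbhs_nbhs; split; [exact: dom_open|exact: chart_at_dom]. Qed.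

Lemma near_img p :
  \forall x \near point_at p, (cmap (chart_at p) @` dom (chart_at p)) x.
Proof.
by apply: open_nbhs_nbhs; split; [exact: img_open|exists p => //; exact: chart_at_dom].
Qed.

Lemma transition_differentiable (c c' : chart R M) q :
  atlas c -> atlas c' -> dom c q -> dom c' q ->
  differentiable (cmap c' \o cinv c) (cmap c q).
Proof.
move=> ac ac' cq c'q; have [df _] := atlas_smooth ac ac' 1%N.
by apply: df; exists q.
Qed.

Lemma transitionK (c c' : chart R M) q v :
  atlas c -> atlas c' -> dom c q -> dom c' q ->
  'd (cmap c \o cinv c') (cmap c' q) ('d (cmap c' \o cinv c) (cmap c q) v) = v.
Proof.
move=> ac ac' cq c'q.
have d1 := transition_differentiable ac ac' cq c'q.
have d2 := transition_differentiable ac' ac c'q cq.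
have e : (cmap c' \o cinv c) (cmap c q) = cmap c' q by rewrite /= cmapK.
rewrite -e in d2 *.
rewrite -[LHS]/(('d (cmap c \o cinv c') ((cmap c' \o cinv c) (cmap c q)) \o
 'd (cmap c' \o cinv c) (cmap c q)) v) -diff_comp//.
rewrite -(near_eq_diff (f := id)).
- by rewrite diff_val.
- exact: ex_diff.
have iq : (cmap c @` dom c) (cmap c q) by exists q.
have n1 : \forall y \near cmap c q, (cmap c @` dom c) y.
  by apply: open_nbhs_nbhs; split => //; exact: img_open.
have n2 : \forall y \near cmap c q, dom c' (cinv c y).
  have := cinv_continuous iq; rewrite /prop_for /continuous_at cmapK// => cc.
  by apply: cc; apply: open_nbhs_nbhs; split => //; exact: dom_open.
near=> y.
have [r cr ry] : (cmap c @` dom c) y by near: y.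
have c'y : dom c' (cinv c y) by near: y.
by rewrite /= cmapK// -ry cmapK.
Unshelve. all: by end_near. Qed.

(* The field with constant components v in chart_at p. *)
Definition constant_field p (v : E) : M -> E := fun q =>
  'd (cmap (chart_at q) \o cinv (chart_at p)) (cmap (chart_at p) q) v.

Lemma constant_fieldE p v : constant_field p v p = v.
Proof.
rewrite /constant_field; set f := _ \o _; set x := cmap _ p.
have fid : \forall y \near x, id y = f y.
  by apply: filterS (near_img p) => _ [r rp <-]; rewrite /f /= cmapK.
have did : differentiable (@id E) x by exact: ex_diff.
by rewrite -(near_eq_diff v did fid) diff_val.
Qed.

(** By [transitionK] the local expression in [chart_at p] is constant. These fields extend arbitrary
    tangent vectors at [p] and are the input of the Gram-Schmidt process. *)
Lemma smooth_constant_field p v : smooth_field p (constant_field p v).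
Proof.
apply: (@smooth_near_cst _ _ _ _ _ v).
apply: filterS (near_img p) => x [q pq <-].
rewrite /local_rep /change_chart /constant_field cmapK//.
exact: (transitionK v (chart_at_atlas p) (chart_at_atlas q) pq (chart_at_dom q)).
Qed.

(** The value of ['d] is a linear map at every point, even where no derivative exists, so
    [local_rep] commutes with sums everywhere. *)
Lemma smooth_fieldD p (X Y : M -> E) : smooth_field p X -> smooth_field p Y ->
  smooth_field p (fun q => X q + Y q).
Proof.
move=> sX sY; rewrite /smooth_field.
rewrite (_ : local_rep _ _ = fun x => local_rep p X x + local_rep p Y x).
  exact: smooth_nearD.
by apply/funext => x; rewrite /local_rep /change_chart linearD.
Qed.

Lemma smooth_fieldZ p (f : M -> R) (X : M -> E) :
  smooth_fun p f -> smooth_field p X -> smooth_field p (fun q => f q *: X q).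
Proof.
move=> sf sX; rewrite /smooth_field.
rewrite (_ : local_rep _ _ = fun x => (f \o cinv (chart_at p)) x *: local_rep p X x).
  exact: smooth_nearZ.
by apply/funext => x; rewrite /local_rep /change_chart linearZ.
Qed.

Lemma smooth_funM p (f g : M -> R) :
  smooth_fun p f -> smooth_fun p g -> smooth_fun p (fun q => f q * g q).
Proof. exact: smooth_nearZ. Qed.

Lemma smooth_fun_cst p (a : R) : smooth_fun p (fun=> a).
Proof. by exists setT; split => // [|k]; [exact: openT|exact: Ck_cst]. Qed.

Lemma smooth_fieldN p (X : M -> E) :
  smooth_field p X -> smooth_field p (fun q => - X q).
Proof.
move=> sX; rewrite (_ : (fun q => - X q) = fun q => -1 *: X q); last first.
  by apply/funext => q; rewrite scaleN1r.
by apply: smooth_fieldZ => //; exact: smooth_fun_cst.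
Qed.

Lemma smooth_fun_invsqrt p (f : M -> R) : smooth_fun p f -> 0 < f p ->
  smooth_fun p (fun q => (Num.sqrt (f q))^-1).
Proof.
move=> sf f0.
by apply: (@smooth_near_invsqrt _ _ _ (f \o cinv (chart_at p))) => //=; rewrite cinv_point_at.
Qed.

Lemma smooth_fun_gt0 p (f : M -> R) : smooth_fun p f -> 0 < f p ->
  \forall q \near p, 0 < f q.
Proof.
move=> sf f0.
have /near_cmap h : \forall x \near point_at p, 0 < (f \o cinv (chart_at p)) x.
  by apply: smooth_near_gt0 => //=; rewrite cinv_point_at.
near=> q.
have dq : dom (chart_at p) q by near: q; exact: near_dom.
by rewrite -(cmapK dq); near: q.
Unshelve. all: by end_near. Qed.

Lemma deriv_near_cst p (f : M -> R) v a :
  (\forall q \near p, f q = a) -> deriv f p v = 0.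
Proof. by move=> /near_cinv fa; exact: diff_near_cst fa. Qed.

Lemma derivN p (f : M -> R) v : smooth_fun p f ->
  deriv (fun q => - f q) p v = - deriv f p v.
Proof.
move=> /smooth_near_differentiable df; rewrite /deriv.
by rewrite (_ : _ \o _ = - (f \o cinv (chart_at p)))// diffN.
Qed.

End Charts.

(** * Adapted frames *)

Section Metric.
Local Open Scope classical_set_scope.
Context {R : realType} {M : manifold5 R} (g : metric M).
Notation E := 'rV[R]_5.
Implicit Types (p q : M) (u v w : E).

Lemma g0l p w : g p 0 w = 0.
Proof. by have := g_linear g p 1 0 0 w; rewrite scaler0 addr0 mul1r => h; lra. Qed.
Lemma gDl p u v w : g p (u + v) w = g p u w + g p v w.
Proof. by have := g_linear g p 1 u v w; rewrite scale1r mul1r. Qed.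
Lemma gZl p a u w : g p (a *: u) w = a * g p u w.
Proof. by have := g_linear g p a u 0 w; rewrite addr0 g0l addr0. Qed.
Lemma gNl p u w : g p (- u) w = - g p u w.
Proof. by rewrite -scaleN1r gZl mulN1r. Qed.
Lemma gBl p u v w : g p (u - v) w = g p u w - g p v w.
Proof. by rewrite gDl gNl. Qed.
Lemma g0r p w : g p w 0 = 0.
Proof. by rewrite g_sym g0l. Qed.
Lemma gDr p u v w : g p w (u + v) = g p w u + g p w v.
Proof. by rewrite !(g_sym _ _ w) gDl. Qed.
Lemma gZr p a u w : g p w (a *: u) = a * g p w u.
Proof. by rewrite !(g_sym _ _ w) gZl. Qed.
Lemma gNr p u w : g p w (- u) = - g p w u.
Proof. by rewrite !(g_sym _ _ w) gNl. Qed.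
Lemma gBr p u v w : g p w (u - v) = g p w u - g p w v.
Proof. by rewrite gDr gNr. Qed.
Lemma g_suml p (I : finType) (F : I -> E) w :
  g p (\sum_i F i) w = \sum_i g p (F i) w.
Proof. by apply: (big_morph (g p ^~ w)) => [u v|]; [exact: gDl|exact: g0l]. Qed.
Lemma g_sumr p (I : finType) (F : I -> E) w :
  g p w (\sum_i F i) = \sum_i g p w (F i).
Proof. by apply: (big_morph (g p w)) => [u v|]; [exact: gDr|exact: g0r]. Qed.

Definition gE := (gDl, gDr, gNl, gNr, gZl, gZr).

Definition normalize (X : M -> E) : M -> E :=
  fun q => (Num.sqrt (g q (X q) (X q)))^-1 *: X q.

Lemma smooth_normalize p X : smooth_field p X -> X p != 0 ->
  smooth_field p (normalize X).
Proof.
move=> sX X0; apply: smooth_fieldZ => //; apply: smooth_fun_invsqrt.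
  exact: g_smooth.
exact: g_pos.
Qed.

Lemma normalize_unit p X : smooth_field p X -> X p != 0 ->
  \forall q \near p, g q (normalize X q) (normalize X q) = 1.
Proof.
move=> sX X0.
have := smooth_fun_gt0 (g_smooth g sX sX) (g_pos g p X0).
apply: filterS => q q0; rewrite /normalize gZl gZr mulrA -invfM -expr2 sqr_sqrtr ?ltW//.
by rewrite mulVf// gt_eqF.
Qed.

End Metric.

Lemma exists_notin_span (F : fieldType) n m (B : 'M[F]_(m, n)) : (m < n)%N ->
  exists v : 'rV[F]_n, ~~ (v <= B)%MS.
Proof.
move=> mn; have : ~~ row_full B.
  by apply/negP => /eqP e; have := rank_leq_row B; rewrite e leqNgt mn.
rewrite -sub1mx => /row_subPn[i ni].
by exists (row i 1%:M).
Qed.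

Section AcmAlgebra.
Local Open Scope classical_set_scope.
Context {R : realType} {M : manifold5 R} (A : acm M).
Notation E := 'rV[R]_5.
Notation g := (acm_g A).
Notation phi := (phi A).
Notation xi := (xi A).
Implicit Types (p q : M) (u v w : E).

Lemma phi_zero p : phi p 0 = 0.
Proof.
have := phi_linear A p 1 0 0; rewrite !scale1r addr0 => h.
by apply: (addrI (phi p 0)); rewrite -h addr0.
Qed.
Lemma phiD p u v : phi p (u + v) = phi p u + phi p v.
Proof. by have := phi_linear A p 1 u v; rewrite !scale1r. Qed.
Lemma phiZ p a u : phi p (a *: u) = a *: phi p u.
Proof. by have := phi_linear A p a u 0; rewrite !addr0 phi_zero addr0. Qed.
Lemma phiN p u : phi p (- u) = - phi p u.
Proof. by rewrite -scaleN1r phiZ scaleN1r. Qed.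
Lemma phiB p u v : phi p (u - v) = phi p u - phi p v.
Proof. by rewrite phiD phiN. Qed.

(** Computing phi^3 u as phi (phi^2 u) and as phi^2 (phi u) gives results that differ by eta(phi u)
    xi. *)
Lemma eta_phi p u : g p (xi p) (phi p u) = 0.
Proof.
have h := phi_compat A p (phi p u) (phi p u).
have h2 := phi_compat A p u u.
have h3 : phi p (phi p (phi p u)) = - phi p u.
  by rewrite (phi_sq A p u) phiD phiN phiZ phi_xi scaler0 addr0.
have h4 : phi p (phi p (phi p u)) = - phi p u + g p (xi p) (phi p u) *: xi p.
  by rewrite phi_sq.
have h5 : g p (xi p) (phi p u) *: xi p = 0.
  by apply: (addrI (- phi p u)); rewrite -h4 h3 addr0.
have := congr1 (g p (xi p)) h5; rewrite gZr xi_unit mulr1 => ->.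
by rewrite g0r.
Qed.

Lemma g_phi_skew p u v : g p u (phi p v) = - g p (phi p u) v.
Proof.
have := phi_compat A p u (phi p v).
rewrite phi_sq eta_phi mulr0 subr0 gDr gNr gZr (g_sym _ _ _ (xi p)) eta_phi mulr0 addr0.
by move=> <-.
Qed.

Lemma g_phi_self p u : g p u (phi p u) = 0.
Proof. by have := g_phi_skew p u u; rewrite (g_sym _ _ (phi p u)) => h; lra. Qed.

End AcmAlgebra.

Section Frames.
Local Open Scope classical_set_scope.
Context {R : realType} {M : manifold5 R} (A : acm M).
Notation E := 'rV[R]_5.
Notation g := (acm_g A).
Notation phi := (phi A).
Notation xi := (xi A).

Lemma forall_I5 (P : 'I_5 -> Prop) : P 0 -> P 1 -> P 2 -> P 3 -> P 4 -> forall i, P i.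
Proof.
move=> P0 P1 P2 P3 P4 [[|[|[|[|[|i]]]]] hi] //.
- by rewrite (_ : Ordinal hi = 0); last exact: val_inj.
- by rewrite (_ : Ordinal hi = 1); last exact: val_inj.
- by rewrite (_ : Ordinal hi = 2); last exact: val_inj.
- by rewrite (_ : Ordinal hi = 3); last exact: val_inj.
- by rewrite (_ : Ordinal hi = 4); last exact: val_inj.
Qed.

(** The signs come from Phi(X, Y) = g(X, phi Y), with phi on the second argument: Phi(u, - phi u) =
    g(u, - phi^2 u) = 1 for a unit vector u orthogonal to xi. *)
Definition frame_of (u v : M -> E) (i : 'I_5) : M -> E :=
  tnth [tuple u; (fun q => - phi q (u q)); v; (fun q => - phi q (v q)); xi] i.

Lemma frame_of_adapted p (u v : M -> E) :
  smooth_field p u -> smooth_field p v ->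
  (\forall q \near p, [/\ g q (u q) (u q) = 1, g q (v q) (v q) = 1,
     g q (xi q) (u q) = 0, g q (xi q) (v q) = 0 &
     g q (u q) (v q) = 0 /\ g q (u q) (phi q (v q)) = 0]) ->
  adapted_frame A p (frame_of u v).
Proof.
move=> su sv H; split.
  apply: forall_I5; rewrite /frame_of !(tnth_nth xi) /=.
  - exact: su.
  - by apply: smooth_fieldN; apply: phi_smooth.
  - exact: sv.
  - by apply: smooth_fieldN; apply: phi_smooth.
  - exact: xi_smooth.
apply: filterS H => q [uu vv xu xv [uv upv]].
have ux : g q (u q) (xi q) = 0 by rewrite g_sym.
have vx : g q (v q) (xi q) = 0 by rewrite g_sym.
have vu : g q (v q) (u q) = 0 by rewrite g_sym.
have vpu : g q (v q) (phi q (u q)) = 0 by rewrite g_phi_skew g_sym upv oppr0.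
have pux : g q (phi q (u q)) (xi q) = 0 by rewrite g_sym eta_phi.
have pvx : g q (phi q (v q)) (xi q) = 0 by rewrite g_sym eta_phi.
have puv : g q (phi q (u q)) (v q) = 0 by rewrite g_sym.
have pvu : g q (phi q (v q)) (u q) = 0 by rewrite g_sym.
have puu : g q (phi q (u q)) (u q) = 0 by rewrite g_sym g_phi_self.
have pvv : g q (phi q (v q)) (v q) = 0 by rewrite g_sym g_phi_self.
have hE := (uu, vv, xu, xv, uv, upv, ux, vx, vu, vpu, pux, pvx, puv, pvu, puu, pvv,
  xi_unit A q, eta_phi A q (u q), eta_phi A q (v q),
  g_phi_self A q (u q), g_phi_self A q (v q)).
apply: forall_I5; apply: forall_I5; rewrite /frame_of /Phi /eta /Phi0 /basis_wedge /eta0 !mxE.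
all: rewrite !(tnth_nth xi) /=.
all: rewrite ?(phiN, phi_xi, phi_sq, opprK) ?(gNl,gNr, gDl, gDr, gZl,gZr, g0r, g0l) ?phi_compat ?hE.
all: split; rewrite ?(oppr0, opprK, mulr0, mul0r, subr0, addr0, add0r, subrr) //.
Qed.

Lemma exists_adapted_frame p : exists e, adapted_frame A p e.
Proof.
have [v vxi] := exists_notin_span (xi p) (isT : (1 < 5)%N).
pose V := constant_field p v.
pose V' := fun q => V q + - (g q (xi q) (V q) *: xi q).
have sxi := xi_smooth A p.
have sV : smooth_field p V := smooth_constant_field p v.
have sV' : smooth_field p V'.
  by apply: smooth_fieldD => //; apply: smooth_fieldN; apply: smooth_fieldZ => //; exact: g_smooth.
have V'0 : V' p != 0.
  apply: contraNneq vxi => /eqP; rewrite /V' /V constant_fieldE subr_eq0 => /eqP ->.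
  exact: scalemx_sub.
pose u := normalize g V'.
have su : smooth_field p u := smooth_normalize g sV' V'0.
have xu q : g q (xi q) (u q) = 0.
  by rewrite /u /normalize /V' !gE xi_unit mulr1 subrr mulr0.
have uu1 : \forall q \near p, g q (u q) (u q) = 1 := normalize_unit g sV' V'0.
move: u su xu uu1 => u su xu uu1.
(* The second vector must avoid [phi u] as well: its orthogonality to [phi u] is, by skewness of
   phi, the condition g(u, phi v) = 0 of [frame_of_adapted]. *)
have [w wB] := exists_notin_span (col_mx (xi p) (col_mx (u p) (phi p (u p))))
  (isT : (1 + (1 + 1) < 5)%N).
pose W := constant_field p w.
have sW : smooth_field p W := smooth_constant_field p w.
have spu := phi_smooth A su.
pose W' := fun q => W q + - (g q (xi q) (W q) *: xi q + (g q (u q) (W q) *: u q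
  + g q (phi q (u q)) (W q) *: phi q (u q))).
have sW' : smooth_field p W'.
  apply: smooth_fieldD => //; apply: smooth_fieldN.
  apply: smooth_fieldD; first by apply: smooth_fieldZ => //; exact: g_smooth.
  by apply: smooth_fieldD; apply: smooth_fieldZ => //; exact: g_smooth.
have W'0 : W' p != 0.
  apply: contraNneq wB => /eqP; rewrite /W' /W constant_fieldE subr_eq0 => /eqP ->.
  rewrite !addmx_sub// scalemx_sub//; apply: submx_trans (submx_refl _) _; rewrite -?addsmxE.
  - exact: addsmxSl.
  - by apply: submx_trans (addsmxSr _ _); rewrite -addsmxE addsmxSl.
  - by apply: submx_trans (addsmxSr _ _); rewrite -addsmxE addsmxSr.
exists (frame_of u (normalize g W')); apply: frame_of_adapted => //.
  exact: smooth_normalize.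
have n2 := normalize_unit g sW' W'0.
near=> q.
have uu : g q (u q) (u q) = 1 by near: q.
have ux : g q (u q) (xi q) = 0 by rewrite g_sym.
have pxu : g q (phi q (u q)) (xi q) = 0 by rewrite g_sym eta_phi.
have pu : g q (phi q (u q)) (u q) = 0 by rewrite g_sym g_phi_self.
have pp : g q (phi q (u q)) (phi q (u q)) = 1 by rewrite phi_compat uu xu mul0r subr0.
split => //.
- by near: q.
- by rewrite /normalize gZr [X in _ * X](_ : _ = 0) ?mulr0// /W' !gE xi_unit xu eta_phi; ring.
split.
- by rewrite /normalize gZr [X in _ * X](_ : _ = 0) ?mulr0// /W' !gE ux uu g_phi_self; ring.
- by rewrite g_phi_skew /normalize gZr [X in _ * X](_ : _ = 0)
    ?mulr0 ?oppr0// /W' !gE pxu pu pp; ring.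
Unshelve. all: by end_near. Qed.

End Frames.

(** * Covariant derivatives and their components *)

Section Tensors.
Local Open Scope classical_set_scope.
Context {R : realType} {M : manifold5 R} (A : acm M).
Notation E := 'rV[R]_5.
Context {nabla : M -> E -> (M -> E) -> E} (lc : levi_civita (acm_g A) nabla).
Notation g := (acm_g A).
Notation phi := (phi A).
Notation xi := (xi A).
Notation phif := (phi_field A).
Implicit Types (p : M) (X Y Z : M -> E).

Definition nabla_phi p (v : E) Z : E := nabla p v (phif Z) - phi p (nabla p v Z).

Lemma smooth_xi p : smooth_field p xi. Proof. exact: xi_smooth. Qed.

Lemma smooth_phif p X : smooth_field p X -> smooth_field p (phif X).
Proof. exact: phi_smooth. Qed.
Hint Resolve smooth_xi smooth_phif : core.

Lemma nabla_etaE p X Y : smooth_field p Y ->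
  nabla_eta A nabla X Y p = g p (nabla p (X p) xi) (Y p).
Proof. by move=> sY; rewrite /nabla_eta /eta (lc_metric lc)// addrK. Qed.

Lemma nabla_PhiE p X Y Z : smooth_field p Y -> smooth_field p Z ->
  nabla_Phi A nabla X Y Z p = g p (Y p) (nabla_phi p (X p) Z).
Proof.
move=> sY sZ; rewrite /nabla_Phi /Phi (lc_metric lc _ (Z := phif Z))//; last exact: smooth_phif.
by rewrite /nabla_phi gBr /phi_field; ring.
Qed.

Lemma Phi_skew p u v : Phi A p u v = - Phi A p v u.
Proof. by rewrite /Phi g_phi_skew g_sym. Qed.

(* The formula nabla_PhiE is tensorial in Y; by skewness nabla_Phi is tensorial in Z as well,
   without any appeal to the locality of nabla. *)
Lemma nabla_Phi_skew p X Y Z : smooth_field p Y -> smooth_field p Z ->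
  nabla_Phi A nabla X Y Z p = - nabla_Phi A nabla X Z Y p.
Proof.
move=> sY sZ; rewrite /nabla_Phi.
rewrite (_ : (fun q => Phi A q (Y q) (Z q)) = fun q => - Phi A q (Z q) (Y q)); last first.
  by apply/funext => q; exact: Phi_skew.
rewrite derivN; last by apply: g_smooth => //; exact: smooth_phif.
by rewrite (Phi_skew _ (nabla _ _ Y)) (Phi_skew _ (Y p)); ring.
Qed.

(** Torsion-freeness turns the four brackets into eight covariant derivatives, which regroup in
    pairs into values of nabla phi. *)
Lemma phi_bracketE p Y Z : smooth_field p Y -> smooth_field p Z ->
  phi_bracket A Y Z p = nabla_phi p (phif Y p) Z - nabla_phi p (phif Z p) Y
    + phi p (nabla_phi p (Z p) Y) - phi p (nabla_phi p (Y p) Z).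
Proof.
move=> sY sZ; have sY' := smooth_phif sY; have sZ' := smooth_phif sZ.
rewrite /phi_bracket /nabla_phi -!(lc_torsion_free lc)// !phiB.
(* The regrouping is linear in the eight vectors; once they are variables it can be checked entry by
   entry. *)
move: (nabla p (phif Y p) (phif Z)) (nabla p (phif Z p) (phif Y)).
move: (phi p (nabla p (phif Y p) Z)) (phi p (nabla p (phif Z p) Y)) => a1 a2 a3 a4.
move: (phi p (nabla p (Y p) (phif Z))) (phi p (nabla p (Z p) (phif Y))) => a5 a6.
move: (phi p (phi p _)) (phi p (phi p _)) => a7 a8.
apply/rowP => i; rewrite !mxE; ring.
Qed.

(** The outer phi in [phi_bracketE] moves onto [X] by skewness, and every term becomes a value of
    nabla Phi or d eta, for which component formulas are available. *)
Lemma NijE p X Y Z : smooth_field p X -> smooth_field p Y -> smooth_field p Z ->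
  Nij A nabla X Y Z p =
    nabla_Phi A nabla (phif Y) X Z p - nabla_Phi A nabla (phif Z) X Y p
    - nabla_Phi A nabla Z (phif X) Y p + nabla_Phi A nabla Y (phif X) Z p
    + eta A p (X p) * deta A nabla Y Z p.
Proof.
move=> sX sY sZ; have sX' := smooth_phif sX.
rewrite /Nij phi_bracketE// !nabla_PhiE// /nabla_phi !phiB !(gBr, gDr).
by rewrite !(g_phi_skew A p (X p)) /phi_field; ring.
Qed.

(** Since [xi, Y] = nabla_xi Y - nabla_Y xi, metric compatibility cancels the derivative along xi
    and leaves the symmetric part of nabla eta. *)
Lemma killingE : killing A xi <-> forall p Y Z, smooth_field p Y -> smooth_field p Z ->
  nabla_eta A nabla Y Z p + nabla_eta A nabla Z Y p = 0.
Proof.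
have e p Y Z : smooth_field p Y -> smooth_field p Z ->
   g p (bracket xi Y p) (Z p) + g p (Y p) (bracket xi Z p)
   = deriv (fun q => g q (Y q) (Z q)) p (xi p)
     - (nabla_eta A nabla Y Z p + nabla_eta A nabla Z Y p).
  move=> sY sZ; rewrite !nabla_etaE// (lc_metric lc)// -!(lc_torsion_free lc)// gBl gBr.
  by rewrite (g_sym _ _ (Y p) (nabla p (Z p) xi)); ring.
split=> h p Y Z sY sZ; have := h p Y Z sY sZ; rewrite ?e//.
  by move=> h'; lra.
by move=> ->; rewrite subr0.
Qed.

Section Components.
Variables (p : M) (e : 'I_5 -> M -> E).
Hypothesis adapted : adapted_frame A p e.

Definition comp X (i : 'I_5) : R := g p (X p) (e i p).
Definition conn (k : 'I_5) : 'M[R]_5 := connection_form A nabla p e (e k p).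

Lemma smooth_frame i : smooth_field p (e i).
Proof. by case: adapted. Qed.
Hint Resolve smooth_frame : core.

Lemma frame_at i j : [/\ g p (e i p) (e j p) = (i == j)%:R,
  Phi A p (e i p) (e j p) = Phi0 R i j & eta A p (e i p) = eta0 R i].
Proof. by case: adapted => _ /nbhs_singleton. Qed.

Lemma frame_orthonormal i j : g p (e i p) (e j p) = (i == j)%:R.
Proof. by case: (frame_at i j). Qed.

(** Orthonormality makes the square matrix with rows e_i injective, hence invertible; pairing an
    expansion with e_j then identifies its coefficients. *)
Lemma frame_expand (u : E) : u = \sum_i g p u (e i p) *: e i p.
Proof.
pose B : 'M[R]_5 := \matrix_i e i p.
have rowsum (v : E) : v *m B = \sum_i v 0 i *: e i p.
  by rewrite mulmx_sum_row; apply: eq_bigr => i _; rewrite rowK.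
have gsum (v : E) j : g p (\sum_i v 0 i *: e i p) (e j p) = v 0 j.
  rewrite g_suml (bigD1 j)//= gZl frame_orthonormal eqxx mulr1 big1 ?addr0// => i /negPf ij.
  by rewrite gZl frame_orthonormal ij mulr0.
have Bu : B \in unitmx.
  rewrite -row_free_unit -kermx_eq0; apply/eqP/row_matrixP => i.
  have : row i (kermx B) *m B = 0 by apply/sub_kermxP; exact: row_sub.
  move: (row i _) => v; rewrite rowsum row0 => v0; apply/rowP => j.
  by rewrite -gsum v0 g0l mxE.
rewrite [LHS](_ : _ = \sum_i (u *m invmx B) 0 i *: e i p); last by rewrite -rowsum mulmxKV.
apply: eq_bigr => i _; congr (_ *: _).
by rewrite -[in RHS](mulmxKV Bu u) rowsum gsum.
Qed.

Lemma field_expand X : X p = \sum_i comp X i *: e i p.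
Proof. exact: frame_expand. Qed.

Lemma eta_comp X : eta A p (X p) = comp X 4.
Proof.
rewrite {1}(field_expand X) /eta g_sumr (bigD1 4)//= big1 ?addr0 => [|i /negPf i4]; rewrite gZr.
  by case: (frame_at 4 4) => _ _; rewrite /eta => ->; rewrite /eta0 eqxx mulr1.
by case: (frame_at i 4) => _ _; rewrite /eta => ->; rewrite /eta0 i4 mulr0.
Qed.

Lemma comp_frame i j : comp (e i) j = (i == j)%:R.
Proof. exact: frame_orthonormal. Qed.

Lemma comp_phif X i : comp (phif X) i = \sum_j Phi0 R i j * comp X j.
Proof.
rewrite /comp g_sym /phi_field g_phi_skew -[RHS]opprK; congr -%R.
rewrite {1}(field_expand X) g_sumr -sumrN; apply: eq_bigr => j _.
rewrite gZr -mulNr mulrC; congr (_ * _).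
by case: (frame_at i j) => _ <- _; rewrite /Phi [in RHS]g_phi_skew opprK.
Qed.

Lemma comp_xi i : comp xi i = eta0 R i.
Proof. by case: (frame_at i i) => _ _ <-. Qed.

Lemma xi_frame : xi p = e 4 p.
Proof.
rewrite (field_expand xi) (bigD1 4)//= big1 ?addr0 => [|i /negPf i4]; rewrite comp_xi /eta0.
  by rewrite eqxx scale1r.
by rewrite i4 scale0r.
Qed.

(** This is where adaptedness near [p], rather than at [p] alone, enters. It is applied to g, Phi
    and eta to obtain the connection components. *)
Lemma deriv_frame (F : M -> E -> E -> R) i j v a :
  (forall q, [/\ g q (e i q) (e j q) = (i == j)%:R,
        Phi A q (e i q) (e j q) = Phi0 R i j & eta A q (e i q) = eta0 R i] ->
     F q (e i q) (e j q) = a) ->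
  deriv (fun q => F q (e i q) (e j q)) p v = 0.
Proof.
move=> Fa; apply: (@deriv_near_cst _ _ _ _ _ a).
by case: adapted => _; apply: filterS => q /(_ i j) /Fa.
Qed.

Lemma nabla_frame v i : nabla p v (e i) = \sum_j connection_form A nabla p e v i j *: e j p.
Proof. by rewrite [LHS]frame_expand; apply: eq_bigr => j _; rewrite mxE. Qed.

Lemma connection_skew v : Lambda2 (connection_form A nabla p e v).
Proof.
apply/matrixP => i j; rewrite !mxE.
have := lc_metric lc v (smooth_frame j) (smooth_frame i).
rewrite (deriv_frame (F := g) _ (a := (j == i)%:R)) => [|q []//].
by rewrite (g_sym _ _ (e j p)) => h; lra.
Qed.

Lemma connection_linear X : connection_form A nabla p e (X p) = \sum_k comp X k *: conn k.
Proof.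
apply/matrixP => i j; rewrite mxE {1}(field_expand X) summxE.
have -> (I : finType) (a : I -> R) (v : I -> E) :
   nabla p (\sum_k a k *: v k) (e i) = \sum_k a k *: nabla p (v k) (e i).
  have lin := lc_linear lc (p := p) _ _ _ (smooth_frame i).
  have n0 : nabla p 0 (e i) = 0.
    have := lin 1 0 0; rewrite !scale1r addr0 => h.
    by apply: (addrI (nabla p 0 (e i))); rewrite -h addr0.
  apply: (big_ind2 (fun x y => nabla p x (e i) = y)) => // [u v1 u' v1' <- <-|k _].
    by rewrite -[u]scale1r lin !scale1r.
  by rewrite -[a k *: v k]addr0 lin n0 addr0.
by rewrite g_suml; apply: eq_bigr => k _; rewrite gZl !mxE.
Qed.

Lemma nabla_eta_comp X Y : smooth_field p Y ->
  nabla_eta A nabla X Y p = \sum_k \sum_j comp X k * comp Y j * conn k 4 j.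
Proof.
move=> sY.
(* [xi_frame] identifies [xi] with [e 4] at [p] only, which does not give equal covariant
   derivatives. Instead eta(e_j) is constant near [p], so the left side is - eta(nabla_X e_j) = -
   omega_j4, and omega is skew. *)
have h j : g p (nabla p (X p) xi) (e j p) = connection_form A nabla p e (X p) 4 j.
  rewrite -nabla_etaE// /nabla_eta (deriv_frame (F := fun q _ v => eta A q v)
    (i := j) (j := j) _ (a := eta0 R j)); last by move=> q [].
  have /matrixP/(_ j 4) := connection_skew (X p); rewrite [RHS]mxE !mxE => ->.
  by rewrite sub0r /eta xi_frame g_sym.
rewrite nabla_etaE// {1}(field_expand Y) g_sumr exchange_big; apply: eq_bigr => j _.
rewrite gZr h connection_linear summxE mulr_sumr; apply: eq_bigr => k _.
by rewrite !mxE; ring.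
Qed.

Lemma nabla_Phi_frame X i j :
  nabla_Phi A nabla X (e i) (e j) p = \sum_k comp X k * (Phi0 R *m conn k - conn k *m Phi0 R) i j.
Proof.
rewrite /nabla_Phi (deriv_frame (F := fun q u v => Phi A q u v) _ (a := Phi0 R i j));
  last by move=> q [].
have h a : Phi A p (nabla p (X p) (e a)) (e j p)
   = (connection_form A nabla p e (X p) *m Phi0 R) a j.
  rewrite nabla_frame /Phi g_suml mxE; apply: eq_bigr => b _; rewrite gZl.
  by case: (frame_at b j) => _ <- _.
have h' : Phi A p (e i p) (nabla p (X p) (e j))
   = - (Phi0 R *m connection_form A nabla p e (X p)) i j.
  rewrite nabla_frame Phi_skew /Phi g_suml mxE -sumrN -sumrN; apply: eq_bigr => b _; rewrite gZl.
  have -> : connection_form A nabla p e (X p) j b = - connection_form A nabla p e (X p) b j.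
    by have /matrixP/(_ b j) := connection_skew (X p); rewrite mxE [in RHS]mxE.
  case: (frame_at b i) => _ + _; rewrite /Phi => ->.
  have -> : Phi0 R b i = - Phi0 R i b by rewrite !mxE ![(b == _) && _]andbC; ring.
  by ring.
rewrite h h' connection_linear mulmx_suml mulmx_sumr !summxE -!sumrN add0r -big_split /=.
apply: eq_bigr => k _.
by rewrite -scalemxAl -scalemxAr !mxE; ring.
Qed.

(** The slot of [Y] is expanded by [nabla_PhiE]; [nabla_Phi_skew] swaps the slots, the same
    expansion applies to [Z], and a second swap restores the order. *)
Lemma nabla_Phi_comp X Y Z : smooth_field p Y -> smooth_field p Z ->
  nabla_Phi A nabla X Y Z p = \sum_k \sum_i \sum_j
    comp X k * comp Y i * comp Z j * (Phi0 R *m conn k - conn k *m Phi0 R) i j.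
Proof.
move=> sY sZ.
have lin W V : smooth_field p W -> smooth_field p V ->
    nabla_Phi A nabla X W V p = \sum_i comp W i * nabla_Phi A nabla X (e i) V p.
  move=> sW sV; rewrite nabla_PhiE// {1}(field_expand W) g_suml.
  by apply: eq_bigr => i _; rewrite gZl nabla_PhiE.
rewrite lin//.
transitivity (\sum_i \sum_j comp Y i * comp Z j * nabla_Phi A nabla X (e i) (e j) p).
  apply: eq_bigr => i _; rewrite nabla_Phi_skew// lin// -sumrN mulr_sumr.
  by apply: eq_bigr => j _; rewrite (nabla_Phi_skew X (smooth_frame j))//; ring.
under eq_bigr do under eq_bigr do rewrite nabla_Phi_frame mulr_sumr.
rewrite [RHS]exchange_big; apply: eq_bigr => i _.
by rewrite [RHS]exchange_big; apply: eq_bigr => j _; apply: eq_bigr => k _; ring.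
Qed.

End Components.
End Tensors.
Arguments conn {R M} A nabla p e k.

(** * Two-forms on the model space *)

Section TwoForms.
Variable R : realType.
Implicit Types (b c : 'M[R]_5) (w : 'I_5 -> 'M[R]_5).

Lemma big_I5 (T : Type) (idx : T) (op : Monoid.law idx) (F : 'I_5 -> T) :
  \big[op/idx]_i F i = op (op (op (op (F 0) (F 1)) (F 2)) (F 3)) (F 4).
Proof.
rewrite !big_ord_recr big_ord0 /= Monoid.mul1m.
by congr (op (op (op (op _ _) _) _) _); congr F; exact: val_inj.
Qed.

Lemma sum_I5 (V : nmodType) (F : 'I_5 -> V) :
  \sum_i F i = F 0 + F 1 + F 2 + F 3 + F 4.
Proof. exact: big_I5. Qed.

Lemma val_I5 : ((0%R : 'I_5) = 0%N :> nat) * ((1%R : 'I_5) = 1%N :> nat) *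
  ((2 : 'I_5) = 2%N :> nat) * ((3 : 'I_5) = 3%N :> nat) * ((4 : 'I_5) = 4%N :> nat).
Proof. by []. Qed.

(** A factor of the Vandermonde product. Written in these differences, [vol5] is evaluated on
    concrete indices by plain arithmetic. *)
Let diff (i j : 'I_5) : R := (j : nat)%:R - (i : nat)%:R.

(* vol5 is multiplied by the Vandermonde determinant 288 of the nodes 0, ..., 4. *)
Lemma vol5E (i j k l m : 'I_5) : vol5 R i j k l m =
  diff i j * diff i k * diff i l * diff i m * diff j k * diff j l * diff j m
  * diff k l * diff k m * diff l m / 288.
Proof.
pose V (t : 'I_5 -> 'I_5) := Vandermonde 5 (\row_(a < 5) (t a)%:R : 'rV[R]_5).
have detV t : \det (V t) =
    diff (t 0) (t 1) * diff (t 0) (t 2) * diff (t 0) (t 3) * diff (t 0) (t 4) * diff (t 1) (t 2)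
    * diff (t 1) (t 3) * diff (t 1) (t 4) * diff (t 2) (t 3) * diff (t 2) (t 4) * diff (t 3) (t 4).
  rewrite det_Vandermonde.
  transitivity (\prod_(i < 5) \prod_(j < 5 | (i < j)%N) ((t j)%:R - (t i)%:R : R)).
    by apply: eq_bigr => a _; apply: eq_bigr => a' _; rewrite !mxE.
  under eq_bigr do rewrite big_mkcond.
  by rewrite !big_I5 /= !mul1r !mulr1 !mulrA.
have V0 : \det (V id) = 288 by rewrite detV /diff !val_I5; ring.
apply: (@mulIf _ (288 : R)); first by rewrite pnatr_eq0.
(* Multiplying [V id] by the transposed matrix of [vol5] selects columns, which replaces the nodes
   0, ..., 4 by i, ..., m. *)
rewrite mulfVK ?pnatr_eq0// -{1}V0 /vol5 -[X in X * _]det_tr mulrC -det_mulmx.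
transitivity (\det (V (tnth [tuple i; j; k; l; m]))); last first.
  by rewrite detV !(tnth_nth i).
congr (\det _); apply/matrixP => a a'; rewrite !mxE.
rewrite (bigD1 (tnth [tuple i; j; k; l; m] a')) //= big1 ?addr0 => [|c cN]; rewrite !mxE.
  by rewrite (eqxx (tnth _ a')) mulr1.
by rewrite eq_sym (negPf cN) mulr0.
Qed.

Lemma star2E b k l m : star2 b k l m =
  b 0 1 * vol5 R 0 1 k l m + b 0 2 * vol5 R 0 2 k l m + b 0 3 * vol5 R 0 3 k l m
  + b 0 4 * vol5 R 0 4 k l m + b 1 2 * vol5 R 1 2 k l m + b 1 3 * vol5 R 1 3 k l m
  + b 1 4 * vol5 R 1 4 k l m + b 2 3 * vol5 R 2 3 k l m + b 2 4 * vol5 R 2 4 k l m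
  + b 3 4 * vol5 R 3 4 k l m.
Proof.
rewrite /star2; under eq_bigr do rewrite big_mkcond.
by rewrite !big_I5 /= !(add0r, addr0, addrA).
Qed.

Lemma eta0E : (eta0 R 0 = 0) * (eta0 R 1 = 0) * (eta0 R 2 = 0) * (eta0 R 3 = 0) * (eta0 R 4 = 1).
Proof. by rewrite /eta0. Qed.

Lemma skewE b i j : Lambda2 b -> b i j = - b j i.
Proof. by move=> /matrixP /(_ j i); rewrite !mxE. Qed.

Lemma skew_diag b i : Lambda2 b -> b i i = 0.
Proof. by move=> bs; have := skewE i i bs => hi; lra. Qed.

Lemma Lambda2D b c : Lambda2 b -> Lambda2 c -> Lambda2 (b + c).
Proof. by rewrite /Lambda2 linearD /= => -> ->; rewrite opprD. Qed.

Lemma Lambda2P b : (forall i j, b i j = - b j i) -> Lambda2 b.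
Proof. by move=> h; apply/matrixP => i j; rewrite !mxE h. Qed.

(** Indexing by naturals lets a matrix be given as a table by pattern matching, whose entries
    compute after [val_I5]. *)
Definition mx_of_nat (f : nat -> nat -> R) : 'M[R]_5 := \matrix_(i, j) f i j.

(* The elements of Lambda2_2, Lambda2_3 and Lambda2_4. *)
Definition sd_mx (c d : R) := mx_of_nat (fun i j => match i, j with
  | 0, 2 => c | 2, 0 => (- c)%R | 1, 3 => (- c)%R | 3, 1 => c
  | 0, 3 => d | 3, 0 => (- d)%R | 1, 2 => d | 2, 1 => (- d)%R | _, _ => 0%R end%N).

Definition asd_mx (a c d : R) := mx_of_nat (fun i j => match i, j with
  | 0, 1 => a | 1, 0 => (- a)%R | 2, 3 => (- a)%R | 3, 2 => a
  | 0, 2 => c | 2, 0 => (- c)%R | 1, 3 => c | 3, 1 => (- c)%R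
  | 0, 3 => d | 3, 0 => (- d)%R | 1, 2 => (- d)%R | 2, 1 => d | _, _ => 0%R end%N).

Definition eta_mx (v : nat -> R) := mx_of_nat (fun i j => match i, j with
  | 4, 4 => 0%R | i, 4 => v i | 4, i => (- v i)%R | _, _ => 0%R end%N).

Lemma Phi0E : Phi0 R = mx_of_nat (fun i j => match i, j with
  | 0, 1 => 1%R | 1, 0 => (- 1)%R | 2, 3 => 1%R | 3, 2 => (- 1)%R | _, _ => 0%R end%N).
Proof.
by apply/matrixP; apply: forall_I5; apply: forall_I5; rewrite !mxE !val_I5 /=;
  rewrite ?(subr0, sub0r, addr0, add0r, oppr0, subrr).
Qed.

Lemma star2_table b :
  ((star2 b 0 1 2 = b 3 4) * (star2 b 0 1 3 = - b 2 4) * (star2 b 0 2 3 = b 1 4) *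
   (star2 b 1 2 3 = - b 0 4) * (star2 b 0 1 4 = b 2 3) * (star2 b 0 2 4 = - b 1 3) *
   (star2 b 0 3 4 = b 1 2) * (star2 b 1 2 4 = b 0 3) * (star2 b 1 3 4 = - b 0 2) *
   (star2 b 2 3 4 = b 0 1))%type.
Proof. by do !split; rewrite star2E !vol5E /diff !val_I5; lra. Qed.

(** On horizontal triples the right side vanishes and the left side is an entry b_i4 up to sign; the
    triples containing 4 give the duality relations. It is used for s = 1 and s = -1. *)
Lemma star2_eigen_entries (s : R) b : Lambda2 b ->
  (forall i j k, star2 b i j k = s * wedge21 b (@eta0 R) i j k) ->
  (forall i, b i 4 = 0) /\ [/\ b 2 3 = s * b 0 1, b 1 3 = - (s * b 0 2) & b 1 2 = s * b 0 3].
Proof.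
move=> bs H.
move: (H 0 1 2) (H 0 1 3) (H 0 2 3) (H 1 2 3) (H 0 1 4) (H 0 2 4) (H 0 3 4).
rewrite !star2_table /wedge21 !eta0E => h1 h2 h3 h4 h5 h6 h7.
by split; [apply: forall_I5; rewrite ?(skew_diag _ bs)//; lra|split; lra].
Qed.

Lemma sd_mx_skew (c d : R) : Lambda2 (sd_mx c d).
Proof.
apply: Lambda2P; apply: forall_I5; apply: forall_I5; rewrite !mxE !val_I5 /=; ring.
Qed.

Lemma asd_mx_skew (a c d : R) : Lambda2 (asd_mx a c d).
Proof.
apply: Lambda2P; apply: forall_I5; apply: forall_I5; rewrite !mxE !val_I5 /=; ring.
Qed.

Lemma eta_mx_skew v : Lambda2 (eta_mx v).
Proof.
apply: Lambda2P; apply: forall_I5; apply: forall_I5; rewrite !mxE !val_I5 /=; ring.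
Qed.

(** Cuts identities of 3-forms from 125 index triples down to the increasing ones. *)
Lemma alternating_eq0 (T : 'I_5 -> 'I_5 -> 'I_5 -> R) :
  (forall i j k, T j i k = - T i j k) -> (forall i j k, T i k j = - T i j k) ->
  (forall i j k : 'I_5, (i < j < k)%N -> T i j k = 0) -> forall i j k, T i j k = 0.
Proof.
move=> T1 T2 T0.
have Tii i k : T i i k = 0 by have := T1 i i k => h; lra.
have Tjj i k : T k i i = 0 by have := T2 k i i => h; lra.
have S (i j k : 'I_5) : (i < j)%N -> T i j k = 0.
  move=> ij; case: (ltngtP j k) => [jk|kj|/val_inj->//]; first by rewrite T0// ij.
  rewrite T2; case: (ltngtP i k) => [ik|ki|/val_inj->]; last by rewrite Tii oppr0.
    by rewrite T0 ?oppr0// ik.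
  by rewrite T1 T0 ?oppr0// ki.
move=> i j k; case: (ltngtP i j) => [ij|ji|/val_inj->//]; first exact: S.
by rewrite T1 S ?oppr0.
Qed.

Lemma star2_eigen (s : R) b : Lambda2 b ->
  (forall i, b i 4 = 0) ->
  b 2 3 = s * b 0 1 -> b 1 3 = - (s * b 0 2) -> b 1 2 = s * b 0 3 ->
  b 0 1 = s * b 2 3 -> b 0 2 = - (s * b 1 3) -> b 0 3 = s * b 1 2 ->
  forall i j k, star2 b i j k = s * wedge21 b (@eta0 R) i j k.
Proof.
move=> bs b4 h1 h2 h3 h4 h5 h6 i j k; apply/eqP; rewrite -subr_eq0; apply/eqP; move: i j k.
apply: alternating_eq0.
- move=> i j k; rewrite !star2E !vol5E /wedge21.
  rewrite (skewE j i bs) (skewE i k bs) (skewE k j bs) /diff; ring.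
- move=> i j k; rewrite !star2E !vol5E /wedge21.
  rewrite (skewE j i bs) (skewE k i bs) (skewE k j bs) /diff; ring.
apply: forall_I5; apply: forall_I5; apply: forall_I5; rewrite !val_I5 // => _.
all: by rewrite star2_table /wedge21 !eta0E ?(skewE 4 _ bs) ?b4; lra.
Qed.

Lemma Phi0_skew : Lambda2 (Phi0 R).
Proof.
rewrite Phi0E; apply: Lambda2P; apply: forall_I5; apply: forall_I5; rewrite !mxE !val_I5 /=; ring.
Qed.

Lemma wedge22_sd (c d : R) i j k l : wedge22 (Phi0 R) (sd_mx c d) i j k l = 0.
Proof.
have P := Phi0_skew; have S := sd_mx_skew c d.
move: j k l; apply: alternating_eq0.
- by move=> j k l; rewrite /wedge22 (skewE k j P) (skewE k j S); ring.
- by move=> j k l; rewrite /wedge22 (skewE l k P) (skewE l k S); ring.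
rewrite /wedge22 Phi0E => j k l; rewrite !mxE; move: i j k l.
by do 4!apply: forall_I5; rewrite !val_I5 //= => _; ring.
Qed.

End TwoForms.

(** * The projection onto u(2)^perp in entries *)

Section ProjectionU2perp.
Variable R : realType.
Implicit Types (b : 'M[R]_5) (w : 'I_5 -> 'M[R]_5).

Lemma skew_ext b b' : Lambda2 b -> Lambda2 b' ->
  (forall i j : 'I_5, (i < j)%N -> b i j = b' i j) -> b = b'.
Proof.
move=> bs b's h; apply/matrixP => i j.
case: (ltngtP i j) => [/h//|ji|/val_inj->]; last by rewrite !skew_diag.
by rewrite skewE// (skewE i j b's) h.
Qed.

Lemma Lambda2_2P b : Lambda2_2 b <-> exists c d, b = sd_mx c d.
Proof.
split=> [[bs bW bS]|[c [d ->]]]; last first.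
{ split; first exact: sd_mx_skew.
    exact: wedge22_sd.
  move=> i j k; rewrite (star2_eigen (s := 1)) ?mul1r//; first exact: sd_mx_skew.
    by apply: forall_I5; rewrite !mxE !val_I5.
  all: by rewrite !mxE !val_I5 /=; ring. }
have [i j k|b4 [h1 h2 h3]] := star2_eigen_entries (s := 1) bs.
  by rewrite mul1r bS.
(* Here Phi /\ b = 0 says b_01 + b_23 = 0, while self-duality says b_23 = b_01; so both entries
   vanish. *)
have := bW 0 1 2 3; rewrite /wedge22 Phi0E !mxE !val_I5 /= => h4.
exists (b 0 2), (b 0 3); apply: skew_ext => //; first exact: sd_mx_skew.
  apply: forall_I5; apply: forall_I5; rewrite !val_I5 // => _;
  rewrite ?mxE ?val_I5 /= ?b4; lra.
Qed.

Lemma u2perp_entries b : u2perp b ->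
  [/\ Lambda2 b, b 0 1 = 0, b 2 3 = 0, b 1 3 = - b 0 2 & b 1 2 = b 0 3].
Proof.
case=> _ [b4 [/Lambda2_2P[c [d ->]] [b4s b4E] ->]].
have e i j : i != 4 -> j != 4 -> b4 i j = 0.
  by move=> /negPf i4 /negPf j4; have := b4E i j 4; rewrite /wedge21 /eta0 eqxx i4 j4 /=
    mulr1 !mulr0 !addr0.
have mE i j : (sd_mx c d + b4) i j = sd_mx c d i j + b4 i j by rewrite mxE.
split; first by apply: Lambda2D => //; exact: sd_mx_skew.
all: by rewrite !mE !e// !mxE !val_I5 /=; ring.
Qed.

Lemma u2_entries b : u2 b ->
  [/\ forall i, b i 4 = 0, b 0 2 = b 1 3 & b 0 3 = - b 1 2].
Proof.
case=> b1 [b3 [[t ->] [bs bS] ->]].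
have [i j k|b4 [h1 h2 h3]] := star2_eigen_entries (s := -1) bs.
  by rewrite mulN1r bS.
rewrite Phi0E; split; last 2 first.
- by rewrite !mxE !val_I5 /=; lra.
- by rewrite !mxE !val_I5 /=; lra.
by apply: forall_I5; rewrite 3!mxE b4 !val_I5 /=; ring.
Qed.

Definition Gamma_mx b := sd_mx ((b 0 2 - b 1 3) / 2) ((b 0 3 + b 1 2) / 2)
  + eta_mx (fun i => b (inord i) 4).

Lemma Gamma_mx_skew b : Lambda2 (Gamma_mx b).
Proof. by apply: Lambda2D; [exact: sd_mx_skew|exact: eta_mx_skew]. Qed.

Lemma Gamma_mx4 b i : Lambda2 b -> Gamma_mx b i 4 = b i 4.
Proof.
move=> bs; move: i; apply: forall_I5; rewrite !mxE !val_I5 /= ?(skew_diag _ bs).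
all: by rewrite ?add0r ?addr0 //; congr (b _ _); apply/val_inj; rewrite /= inordK.
Qed.

(** Both halves of [xget_unique] are needed, as [xget] would otherwise return its default 0.
    Uniqueness holds because [u2perp_entries] and [u2_entries] together determine every entry. *)
Lemma pr_u2perpE b : Lambda2 b -> pr_u2perp b = Gamma_mx b.
Proof.
move=> bs.
have G4 i := Gamma_mx4 i bs; have Gs := Gamma_mx_skew b.
apply: xget_unique.
- split.
    { exists (sd_mx ((b 0 2 - b 1 3) / 2) ((b 0 3 + b 1 2) / 2)), (eta_mx (fun i => b (inord i) 4)).
    split => //; first by apply/Lambda2_2P; eexists; eexists.
    split; first exact: eta_mx_skew.
    apply: forall_I5; apply: forall_I5; apply: forall_I5.
    all: by rewrite /wedge21 !eta0E !mxE !val_I5 /=; ring. }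
  (* The complement consists of the multiple of Phi0 and the anti-self-dual part in the splitting of
     the horizontal part of [b]. *)
  exists (((b 0 1 + b 2 3) / 2) *: Phi0 R),
    (asd_mx ((b 0 1 - b 2 3) / 2) ((b 0 2 + b 1 3) / 2) ((b 0 3 - b 1 2) / 2)).
  split; first by eexists.
    { split; first exact: asd_mx_skew.
    move=> i j k; rewrite (star2_eigen (s := -1)) ?mulN1r//; first exact: asd_mx_skew.
    by apply: forall_I5; rewrite !mxE !val_I5.
    all: by rewrite !mxE !val_I5 /=; ring. }
  rewrite Phi0E; apply: skew_ext.
  - by rewrite /Lambda2 linearB /= bs Gs opprK opprB addrC.
  - apply: Lambda2D; last exact: asd_mx_skew.
    apply: Lambda2P; apply: forall_I5; apply: forall_I5; rewrite !mxE !val_I5 /=; ring.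
  apply: forall_I5; apply: forall_I5; rewrite !val_I5 // => _;
  rewrite [LHS]mxE [X in _ + X]mxE ?G4 !mxE !val_I5 /=; lra.
- move=> c [/u2perp_entries[cs c01 c23 c13 c12]] /u2_entries[bc4 bc02 bc03].
apply: skew_ext => //.
move: bc02 bc03; rewrite !mxE => bc02 bc03.
have c4 i : c i 4 = b i 4 by have := bc4 i; rewrite !mxE => h; lra.
apply: forall_I5; apply: forall_I5; rewrite !val_I5 // => _; rewrite ?G4 ?c4//;
 rewrite !mxE !val_I5 /=; lra.
Qed.

End ProjectionU2perp.

(** * Tensors on the model space *)

Section ModelTensors.
Variable R : realType.
Notation vec := ('I_5 -> R).
Implicit Types (b : 'M[R]_5) (w : 'I_5 -> 'M[R]_5) (x y z : vec).

Definition phi0 x : vec := fun i => \sum_j Phi0 R i j * x j.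
(** [Hform] and [Fform] are nabla eta and nabla Phi in components, by [nabla_eta_comp] and
    [nabla_Phi_comp]; [Nform] copies the right side of [NijE]. *)
Definition Hform w x y : R := \sum_k \sum_j x k * y j * w k 4 j.
Definition Fform w x y z : R :=
  \sum_k \sum_i \sum_j x k * y i * z j * (Phi0 R *m w k - w k *m Phi0 R) i j.
Definition dform w x y : R := Hform w x y - Hform w y x.
Definition dPhiform w x y z : R := Fform w x y z + Fform w y z x + Fform w z x y.
Definition Nform w x y z : R :=
  Fform w (phi0 y) x z - Fform w (phi0 z) x y - Fform w z (phi0 x) y
  + Fform w y (phi0 x) z + x 4 * dform w y z.
Definition gform w x y : R := dPhiform w (@eta0 R) (phi0 x) y.

Definition basis_vec (i : 'I_5) : vec := fun j => (i == j)%:R.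

(* The intrinsic torsion of w is in W4 + W7, with C = sd_mx c d and B = sd_mx b1 b2; the
   u(2) part of w is arbitrary. *)
Definition normal_torsion w (c d b1 b2 : R) : Prop := forall k,
  [/\ forall i, w k i 4 = sd_mx c d k i,
      w k 0 2 - w k 1 3 = 2 * b1 * eta0 R k
    & w k 0 3 + w k 1 2 = 2 * b2 * eta0 R k].

(** The bilinear form with matrix [sd_mx c d]. *)
Definition sd_form (c d : R) x y : R :=
  c * (x 0 * y 2 - x 2 * y 0 - x 1 * y 3 + x 3 * y 1)
  + d * (x 0 * y 3 - x 3 * y 0 + x 1 * y 2 - x 2 * y 1).

Lemma phi0E x : ((phi0 x 0 = x 1) * (phi0 x 1 = - x 0) * (phi0 x 2 = x 3) *
  (phi0 x 3 = - x 2) * (phi0 x 4 = 0))%type.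
Proof. by rewrite /phi0 !sum_I5 Phi0E !mxE !val_I5 /=; do !split; ring. Qed.

(** Only the combinations that vanish on u(2) by [u2_entries] appear: u(2) is the centralizer of
    Phi0 in so(5), so nabla Phi sees the connection through Gamma alone. *)
Lemma Phi0_commutator_entries b i j : Lambda2 b -> (Phi0 R *m b - b *m Phi0 R) i j =
  mx_of_nat (fun i j => match i, j with
  | 0%N, 2%N | 3%N, 1%N => b 0 3 + b 1 2 | 2%N, 0%N | 1%N, 3%N => - (b 0 3 + b 1 2)
  | 0%N, 3%N | 1%N, 2%N => - (b 0 2 - b 1 3) | 3%N, 0%N | 2%N, 1%N => b 0 2 - b 1 3
  | 0%N, 4%N => b 1 4 | 4%N, 0%N => - b 1 4 | 1%N, 4%N => - b 0 4 | 4%N, 1%N => b 0 4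
  | 2%N, 4%N => b 3 4 | 4%N, 2%N => - b 3 4 | 3%N, 4%N => - b 2 4 | 4%N, 3%N => b 2 4
  | _, _ => 0 end) i j.
Proof.
move=> bs.
have -> : (Phi0 R *m b - b *m Phi0 R) i j
    = \sum_l Phi0 R i l * b l j - \sum_l b i l * Phi0 R l j by rewrite !mxE.
rewrite Phi0E !sum_I5 !mxE; move: i j; apply: forall_I5; apply: forall_I5; rewrite !val_I5 /=.
all: rewrite ?(skew_diag _ bs) ?(skewE 1 0 bs) ?(skewE 2 0 bs) ?(skewE 3 0 bs) ?(skewE 4 0 bs)
  ?(skewE 2 1 bs) ?(skewE 3 1 bs) ?(skewE 4 1 bs) ?(skewE 3 2 bs) ?(skewE 4 2 bs)
  ?(skewE 4 3 bs); ring.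
Qed.

Lemma FformE w x y z : (forall k, Lambda2 (w k)) -> Fform w x y z =
  \sum_k x k * ((w k 0 3 + w k 1 2) * (y 0 * z 2 - y 2 * z 0 - y 1 * z 3 + y 3 * z 1)
   - (w k 0 2 - w k 1 3) * (y 0 * z 3 - y 3 * z 0 + y 1 * z 2 - y 2 * z 1)
   + w k 1 4 * (y 0 * z 4 - y 4 * z 0) - w k 0 4 * (y 1 * z 4 - y 4 * z 1)
   + w k 3 4 * (y 2 * z 4 - y 4 * z 2) - w k 2 4 * (y 3 * z 4 - y 4 * z 3)).
Proof.
move=> ws; apply: eq_bigr => k _.
under eq_bigr do under eq_bigr do rewrite (Phi0_commutator_entries _ _ (ws k)).
by rewrite !sum_I5 !mxE !val_I5; ring.
Qed.

Lemma HformE w x y : (forall k, Lambda2 (w k)) -> Hform w x y =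
  - \sum_k x k * (w k 0 4 * y 0 + w k 1 4 * y 1 + w k 2 4 * y 2 + w k 3 4 * y 3).
Proof.
move=> ws; rewrite -sumrN; apply: eq_bigr => k _; have s := ws k.
rewrite !sum_I5 (skew_diag _ s) (skewE 4 0 s) (skewE 4 1 s) (skewE 4 2 s) (skewE 4 3 s); ring.
Qed.

Section Normal.
Variables (w : 'I_5 -> 'M[R]_5) (c d b1 b2 : R).
Hypothesis ws : forall k, Lambda2 (w k).
Hypothesis wn : normal_torsion w c d b1 b2.

Lemma Fform_normal x y z : Fform w x y z =
  x 4 * (2 * b2 * (y 0 * z 2 - y 2 * z 0 - y 1 * z 3 + y 3 * z 1)
   - 2 * b1 * (y 0 * z 3 - y 3 * z 0 + y 1 * z 2 - y 2 * z 1))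
  + (c * x 3 - d * x 2) * (y 0 * z 4 - y 4 * z 0)
  + (c * x 2 + d * x 3) * (y 1 * z 4 - y 4 * z 1)
  + (d * x 0 - c * x 1) * (y 2 * z 4 - y 4 * z 2)
  - (c * x 0 + d * x 1) * (y 3 * z 4 - y 4 * z 3).
Proof.
have w4 k i : w k i 4 = sd_mx c d k i by case: (wn k).
have w02 k : w k 0 2 - w k 1 3 = 2 * b1 * eta0 R k by case: (wn k).
have w03 k : w k 0 3 + w k 1 2 = 2 * b2 * eta0 R k by case: (wn k).
rewrite FformE//; under eq_bigr do rewrite !w4 w02 w03.
by rewrite !sum_I5 !mxE !val_I5 /= !eta0E; ring.
Qed.

Lemma Hform_normal x y : Hform w x y = - sd_form c d x y.
Proof.
have w4 k i : w k i 4 = sd_mx c d k i by case: (wn k).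
rewrite HformE//; under eq_bigr do rewrite !w4.
by rewrite !sum_I5 !mxE !val_I5 /= /sd_form; ring.
Qed.

Lemma dform_normal x y : dform w x y = - 2 * sd_form c d x y.
Proof. by rewrite /dform !Hform_normal /sd_form; ring. Qed.

(** Total skewness compares the coefficients 4 C and 2 (B + C), which agree exactly if B = C; then N
    = - 4 C /\ eta. *)
Lemma Nform_normal x y z : Nform w x y z = - 4 * x 4 * sd_form c d y z
  + 2 * y 4 * sd_form (b1 + c) (b2 + d) x z - 2 * z 4 * sd_form (b1 + c) (b2 + d) x y.
Proof. by rewrite /Nform dform_normal !Fform_normal !phi0E /sd_form; ring. Qed.

Lemma gform_normal x y : gform w x y = 2 * sd_form (b1 + c) (b2 + d) x y.
Proof. by rewrite /gform /dPhiform !Fform_normal !phi0E !eta0E /sd_form; ring. Qed.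

Lemma normal_killing x y : Hform w x y + Hform w y x = 0.
Proof. by rewrite !Hform_normal /sd_form; ring. Qed.

Lemma normal_Nform_horizontal x y z : x 4 = 0 -> y 4 = 0 -> z 4 = 0 -> Nform w x y z = 0.
Proof. by move=> x4 y4 z4; rewrite Nform_normal x4 y4 z4; ring. Qed.

Lemma normal_dPhi_horizontal x y z : x 4 = 0 -> y 4 = 0 -> z 4 = 0 -> dPhiform w x y z = 0.
Proof. by move=> x4 y4 z4; rewrite /dPhiform !Fform_normal x4 y4 z4; ring. Qed.

Lemma normal_Nform_xi y z : Nform w (@eta0 R) y z = 2 * dform w y z.
Proof. by rewrite Nform_normal dform_normal !eta0E /sd_form !eta0E; ring. Qed.

Lemma normal_gform x y : gform w x y = Nform w (phi0 x) (phi0 y) (@eta0 R).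
Proof. by rewrite gform_normal Nform_normal !eta0E /sd_form !phi0E; ring. Qed.

Lemma normal_gform_skew x y : gform w x y = - gform w y x.
Proof. by rewrite !gform_normal /sd_form; ring. Qed.

End Normal.
End ModelTensors.

(** * The classes W4 and W7 in terms of B and C *)

Section TorsionClasses.
Variable R : realType.
Notation vec := ('I_5 -> R).
Implicit Types (x y z : vec).
Variable w : 'I_5 -> 'M[R]_5.
Hypothesis ws : forall k, Lambda2 (w k).
Notation T := (fun k i j => pr_u2perp (w k) i j).
Notation delta := (@basis_vec R).

(** The tensor is C /\ eta + eta (x) (B - C). Its (k, i, 4) component is C(e_k, e_i) for horizontal
    i, and for k = 4 its horizontal part is C + (B - C) = B. With star b = b /\ eta on Lambda2_2,
    [theta] and [vartheta] take this shape. *)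
Lemma torsion_normalP (c d b1 b2 : R) :
  (forall k i j, T k i j = wedge21 (sd_mx c d) (@eta0 R) k i j
     + eta0 R k * sd_mx (b1 - c) (b2 - d) i j)
  <-> normal_torsion w c d b1 b2.
Proof.
split=> [h k|h k i j].
  have hk i j := h k i j; rewrite (pr_u2perpE (ws k)) in hk.
  split.
  - move=> i; have := hk i 4; rewrite Gamma_mx4// /wedge21 => ->.
    have e k' : sd_mx c d k' 4 = 0 by move: k'; apply: forall_I5; rewrite !mxE !val_I5.
    have e' k' : sd_mx c d 4 k' = 0 by move: k'; apply: forall_I5; rewrite !mxE !val_I5.
    by rewrite !e e' [sd_mx (b1 - c) _ i 4](_ : _ = 0) ?eta0E;
      [ring|move: i; apply: forall_I5; rewrite !mxE !val_I5].
  - by have := hk 0 2; move: k {hk}; apply: forall_I5;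
      rewrite /wedge21 !eta0E !mxE !val_I5 /=; lra.
  - by have := hk 0 3; move: k {hk}; apply: forall_I5;
      rewrite /wedge21 !eta0E !mxE !val_I5 /=; lra.
have w4 k' i' : w k' i' 4 = sd_mx c d k' i' by case: (h k').
have w02 k' : w k' 0 2 - w k' 1 3 = 2 * b1 * eta0 R k' by case: (h k').
have w03 k' : w k' 0 3 + w k' 1 2 = 2 * b2 * eta0 R k' by case: (h k').
pose S k : 'M[R]_5 := \matrix_(i, j) (wedge21 (sd_mx c d) (@eta0 R) k i j
  + eta0 R k * sd_mx (b1 - c) (b2 - d) i j).
have SE k' i' j' : S k' i' j' = wedge21 (sd_mx c d) (@eta0 R) k' i' j'
  + eta0 R k' * sd_mx (b1 - c) (b2 - d) i' j' by rewrite mxE.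
suff -> : pr_u2perp (w k) = S k by rewrite SE.
rewrite pr_u2perpE//; apply: skew_ext; first exact: Gamma_mx_skew.
  apply: Lambda2P => i' j'; rewrite !SE /wedge21.
  rewrite (skewE i' j' (sd_mx_skew c d)) (skewE i' k (sd_mx_skew c d)).
  rewrite (skewE j' k (sd_mx_skew c d)) (skewE i' j' (sd_mx_skew (b1 - c) (b2 - d))); ring.
have G4 i' : Gamma_mx (w k) i' 4 = sd_mx c d k i' by rewrite Gamma_mx4.
have G02 : Gamma_mx (w k) 0 2 = b1 * eta0 R k.
  by have := w02 k; rewrite !mxE !val_I5 /=; lra.
have G03 : Gamma_mx (w k) 0 3 = b2 * eta0 R k.
  by have := w03 k; rewrite !mxE !val_I5 /=; lra.
have G13 : Gamma_mx (w k) 1 3 = - (b1 * eta0 R k).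
  by have := w02 k; rewrite !mxE !val_I5 /=; lra.
have G12 : Gamma_mx (w k) 1 2 = b2 * eta0 R k.
  by have := w03 k; rewrite !mxE !val_I5 /=; lra.
have G01 : Gamma_mx (w k) 0 1 = 0 by rewrite !mxE !val_I5 /=; ring.
have G23 : Gamma_mx (w k) 2 3 = 0 by rewrite !mxE !val_I5 /=; ring.
apply: forall_I5; apply: forall_I5; rewrite !val_I5 // => _;
  rewrite ?G4 ?G02 ?G03 ?G13 ?G12 ?G01 ?G23 {G4 G02 G03 G13 G12 G01 G23 w4 w02 w03 h};
  move: k; apply: forall_I5;
  by rewrite !SE /wedge21 !eta0E ![sd_mx _ _ _ _]mxE !val_I5 /=; ring.
Qed.

Lemma star2_W (c d : R) i j k : star2 (sd_mx c d) i j k = wedge21 (sd_mx c d) (@eta0 R) i j k.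
Proof.
have [_ _ ->//] : Lambda2_2 (sd_mx c d) by apply/Lambda2_2P; exists c, d.
Qed.

Lemma sd_mx_linear (a a' c d c' d' : R) i j :
  sd_mx (a * c + a' * c') (a * d + a' * d') i j = a * sd_mx c d i j + a' * sd_mx c' d' i j.
Proof.
by move: i j; apply: forall_I5; apply: forall_I5; rewrite !mxE !val_I5 /=; ring.
Qed.

Lemma W4_plus_W7_normal : W4_plus_W7 T <-> exists c d b1 b2 : R, normal_torsion w c d b1 b2.
Proof.
split=> [[T4 [T7 [[_ [/Lambda2_2P[c4 [d4 ->]] e4]] [_ [/Lambda2_2P[c7 [d7 ->]] e7]] eT]]]|].
  (* The sum of theta(b4) and vartheta(b7) is (b4 - b7) /\ eta + 3 eta (x) b7, so C = b4 - b7 and B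
     = C + 3 b7. *)
  exists (c4 - c7), (d4 - d7), (c4 + 2 * c7), (d4 + 2 * d7).
  apply/torsion_normalP => k i j; rewrite eT e4 e7 /theta /vartheta !star2_W /wedge21.
  have l1 i' j' : sd_mx (c4 - c7) (d4 - d7) i' j' = sd_mx c4 d4 i' j' - sd_mx c7 d7 i' j'.
    have := sd_mx_linear 1 (-1) c4 d4 c7 d7 i' j'; rewrite !mul1r !mulN1r; exact.
  have l2 : sd_mx (c4 + 2 * c7 - (c4 - c7)) (d4 + 2 * d7 - (d4 - d7)) i j = 3 * sd_mx c7 d7 i j.
    have := sd_mx_linear 3 0 c7 d7 0 0 i j; rewrite !mul0r !addr0 => <-.
    by congr (sd_mx _ _ _ _); ring.
  by rewrite !l1 l2; ring.
case=> c [d [b1 [b2 /torsion_normalP h]]].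
(* Inverting these relations gives b7 = (B - C) / 3 and b4 = C + b7. *)
pose c7 := 3^-1 * (b1 - c); pose d7 := 3^-1 * (b2 - d).
exists (theta (sd_mx (c + c7) (d + d7))), (vartheta (sd_mx c7 d7)); split.
- by exists (sd_mx (c + c7) (d + d7)); split => //; apply/Lambda2_2P; eexists; eexists.
- by exists (sd_mx c7 d7); split => //; apply/Lambda2_2P; eexists; eexists.
move=> k i j; rewrite h /theta /vartheta !star2_W /wedge21.
have l1 i' j' : sd_mx (c + c7) (d + d7) i' j' = sd_mx c d i' j' + sd_mx c7 d7 i' j'.
  have := sd_mx_linear 1 1 c d c7 d7 i' j'; rewrite !mul1r; exact.
have l2 : sd_mx (b1 - c) (b2 - d) i j = 3 * sd_mx c7 d7 i j.
  have := sd_mx_linear 3 0 c7 d7 0 0 i j; rewrite !mul0r !addr0 => <-.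
  by congr (sd_mx _ _ _ _); rewrite /c7 /d7; field.
by rewrite !l1 l2; ring.
Qed.

Lemma W4_normal : W4 T <-> exists c d, normal_torsion w c d c d.
Proof.
have e0 c d i j : sd_mx (c - c) (d - d) i j = 0 :> R.
  have := sd_mx_linear 0 0 0 0 0 0 i j; rewrite !mul0r !addr0 => <-.
  by rewrite !subrr.
split=> [[_ [/Lambda2_2P[c [d ->]] e]]|[c [d /torsion_normalP h]]].
  by exists c, d; apply/torsion_normalP => k i j; rewrite e /theta star2_W e0; ring.
exists (sd_mx c d); split; first by apply/Lambda2_2P; exists c, d.
by move=> k i j; rewrite h e0 /theta star2_W; ring.
Qed.

Lemma W7_normal : W7 T <-> exists c d, normal_torsion w c d (- 2 * c) (- 2 * d).
Proof.
have e0 c d i j : sd_mx (- 2 * c - c) (- 2 * d - d) i j = - 3 * sd_mx c d i j :> R.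
  have := sd_mx_linear (-3) 0 c d 0 0 i j; rewrite !mul0r !addr0 => <-.
  by congr (sd_mx _ _ _ _); ring.
have eN c d i j : sd_mx (- c) (- d) i j = - sd_mx c d i j :> R.
  have := sd_mx_linear (-1) 0 c d 0 0 i j; rewrite !mul0r !addr0 !mulN1r; exact.
split=> [[_ [/Lambda2_2P[c [d ->]] e]]|[c [d /torsion_normalP h]]].
  (* For vartheta(b) the coefficient of the wedge term is - b, so C = - b and B = C + 3 b = - 2
     C. *)
  exists (-c), (-d); apply/torsion_normalP => k i j.
  by rewrite e /vartheta star2_W e0 /wedge21 !eN; ring.
exists (sd_mx (-c) (-d)); split; first by apply/Lambda2_2P; eexists; eexists.
by move=> k i j; rewrite h e0 /vartheta star2_W /wedge21 !eN; ring.
Qed.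

End TorsionClasses.

(** * Recovering the torsion from values on basis vectors *)

Section BasisVectors.
Variable R : realType.
Notation vec := ('I_5 -> R).
Implicit Types (x y z : vec).
Variable w : 'I_5 -> 'M[R]_5.
Hypothesis ws : forall k, Lambda2 (w k).
Notation T := (fun k i j => pr_u2perp (w k) i j).
Notation delta := (@basis_vec R).

Lemma delta_I5 :
  ((delta 0 0 = 1) * (delta 0 1 = 0) * (delta 0 2 = 0) * (delta 0 3 = 0) * (delta 0 4 = 0) *
  (delta 1 0 = 0) * (delta 1 1 = 1) * (delta 1 2 = 0) * (delta 1 3 = 0) * (delta 1 4 = 0) *
  (delta 2 0 = 0) * (delta 2 1 = 0) * (delta 2 2 = 1) * (delta 2 3 = 0) * (delta 2 4 = 0) *
  (delta 3 0 = 0) * (delta 3 1 = 0) * (delta 3 2 = 0) * (delta 3 3 = 1) * (delta 3 4 = 0) *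
  (delta 4 0 = 0) * (delta 4 1 = 0) * (delta 4 2 = 0) * (delta 4 3 = 0) * (delta 4 4 = 1))%type.
Proof. by []. Qed.

Lemma normal_of_horizontal :
  (forall i j, Hform w (delta i) (delta j) + Hform w (delta j) (delta i) = 0) ->
  (forall i j k : 'I_5, i != 4 -> j != 4 -> k != 4 ->
     Nform w (delta i) (delta j) (delta k) = 0 /\ dPhiform w (delta i) (delta j) (delta k) = 0) ->
  (forall i j, Nform w (@eta0 R) (delta i) (delta j) = 2 * dform w (delta i) (delta j)) ->
  exists c d b1 b2 : R, normal_torsion w c d b1 b2.
Proof.
move=> kil hor Nxi.
have H i j : Hform w (delta i) (delta j) = - w i j 4.
  rewrite HformE// (bigD1 i)//= big1 ?addr0 => [|k /negPf ki].
    rewrite [X in X * _]/basis_vec eqxx mul1r; congr -%R.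
    by move: j; apply: forall_I5; rewrite !delta_I5 ?(skew_diag _ (ws i)); ring.
  by rewrite /basis_vec eq_sym ki mul0r.
have s k : w k 4 4 = 0 by rewrite (skew_diag _ (ws k)).
have w4 i j : w i j 4 = - w j i 4 by have := kil i j; rewrite !H => h; lra.
have w44 i : w 4 i 4 = 0 by rewrite w4 s oppr0.
have wd i : w i i 4 = 0 by have := w4 i i => h; lra.
have F k y z : Fform w (delta k) y z =
    (w k 0 3 + w k 1 2) * (y 0 * z 2 - y 2 * z 0 - y 1 * z 3 + y 3 * z 1)
    - (w k 0 2 - w k 1 3) * (y 0 * z 3 - y 3 * z 0 + y 1 * z 2 - y 2 * z 1)
    + w k 1 4 * (y 0 * z 4 - y 4 * z 0) - w k 0 4 * (y 1 * z 4 - y 4 * z 1)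
    + w k 3 4 * (y 2 * z 4 - y 4 * z 2) - w k 2 4 * (y 3 * z 4 - y 4 * z 3).
  rewrite FformE// (bigD1 k)//= big1 ?addr0 => [|k' /negPf k'k]; rewrite /basis_vec.
    by rewrite eqxx mul1r.
  by rewrite eq_sym k'k mul0r.
have D i j k : i != 4 -> j != 4 -> k != 4 -> dPhiform w (delta i) (delta j) (delta k) = 0.
  by move=> i4 j4 k4; case: (hor i j k i4 j4 k4).
have N i j k : i != 4 -> j != 4 -> k != 4 -> Nform w (delta i) (delta j) (delta k) = 0.
  by move=> i4 j4 k4; case: (hor i j k i4 j4 k4).
(* Put a_k = w_k02 - w_k13 and b_k = w_k03 + w_k12. Here d Phi pairs a_0 with b_1, b_0 with a_1, a_2
   with b_3 and b_2 with a_3; N below gives the same pairs with the opposite relative sign. Hence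
   all a_k and b_k with k < 4 vanish. *)
have D1 : w 0 0 2 - w 0 1 3 + (w 1 0 3 + w 1 1 2) = 0.
  by have := D 0 1 2 isT isT isT; rewrite /dPhiform !F !delta_I5; lra.
have D2 : w 0 0 3 + w 0 1 2 - (w 1 0 2 - w 1 1 3) = 0.
  by have := D 0 1 3 isT isT isT; rewrite /dPhiform !F !delta_I5; lra.
have D3 : w 2 0 2 - w 2 1 3 + (w 3 0 3 + w 3 1 2) = 0.
  by have := D 0 2 3 isT isT isT; rewrite /dPhiform !F !delta_I5; lra.
have D4 : w 2 0 3 + w 2 1 2 - (w 3 0 2 - w 3 1 3) = 0.
  by have := D 1 2 3 isT isT isT; rewrite /dPhiform !F !delta_I5; lra.
have phi_delta : [/\ phi0 (delta 0) = (fun i => - delta 1 i), phi0 (delta 1) = delta 0,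
    phi0 (delta 2) = (fun i => - delta 3 i) & phi0 (delta 3) = delta 2].
  split; apply/funext; apply: forall_I5; rewrite !phi0E !delta_I5; ring.
have FN k y z : Fform w (fun i => - delta k i) y z = - Fform w (delta k) y z.
  by rewrite !FformE// -sumrN; apply: eq_bigr => l _; ring.
have [p0 p1 p2 p3] := phi_delta.
have N1 : w 0 0 2 - w 0 1 3 - (w 1 0 3 + w 1 1 2) = 0.
  by have := N 0 0 2 isT isT isT; rewrite /Nform p0 p2 !FN !F !delta_I5; lra.
have N2 : w 0 0 3 + w 0 1 2 + (w 1 0 2 - w 1 1 3) = 0.
  by have := N 0 0 3 isT isT isT; rewrite /Nform p0 p3 !FN !F !delta_I5; lra.
have N3 : w 2 0 2 - w 2 1 3 - (w 3 0 3 + w 3 1 2) = 0.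
  by have := N 2 2 0 isT isT isT; rewrite /Nform p0 p2 !FN !F !delta_I5; lra.
have N4 : w 2 0 3 + w 2 1 2 + (w 3 0 2 - w 3 1 3) = 0.
  by have := N 2 2 1 isT isT isT; rewrite /Nform p1 p2 !FN !F !delta_I5; lra.
(* In general N(xi, Y, Z) = d eta(Y, Z) - d eta(phi Y, phi Z). The hypothesis thus says that d eta
   changes sign under phi, which for a 2-form annihilated by xi means membership in Lambda2_2. *)
have X1 : w 0 1 4 = 0.
  by have := Nxi 0 1; rewrite /Nform p0 p1 /dform !FN !H !F !delta_I5 !phi0E !eta0E;
    have := w4 0 1; lra.
have X2 : w 2 3 4 = 0.
  by have := Nxi 2 3; rewrite /Nform p2 p3 /dform !FN !H !F !delta_I5 !phi0E !eta0E;
    have := w4 2 3; lra.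
have X3 : w 1 3 4 = - w 0 2 4.
  have := Nxi 0 2; rewrite /Nform p0 p2 /dform !FN !H !F !delta_I5 !phi0E !eta0E.
  by have := w4 0 2; have := w4 1 3; lra.
have X4 : w 1 2 4 = w 0 3 4.
  have := Nxi 0 3; rewrite /Nform p0 p3 /dform !FN !H !F !delta_I5 !phi0E !eta0E.
  by have := w4 0 3; have := w4 1 2; lra.
clear - w4 w44 wd s D1 D2 D3 D4 N1 N2 N3 N4 X1 X2 X3 X4.
(* C is read off the last column, and B is the projection of omega(xi), on whose horizontal part no
   condition was imposed. *)
exists (w 0 2 4), (w 0 3 4), ((w 4 0 2 - w 4 1 3) / 2), ((w 4 0 3 + w 4 1 2) / 2).
move=> k; split.
- have := w4 0 1; have := w4 0 2; have := w4 0 3; have := w4 1 2; have := w4 1 3; have := w4 2 3.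
  move: D1 D2 D3 D4 N1 N2 N3 N4 => _ _ _ _ _ _ _ _ h1 h2 h3 h4 h5 h6; move: k.
  by do 2!apply: forall_I5; rewrite !mxE !val_I5 /= ?s ?w44 ?wd; lra.
- by move: k; apply: forall_I5; rewrite !eta0E; lra.
- by move: k; apply: forall_I5; rewrite !eta0E; lra.
Qed.

Section Normal.
Variables (c d b1 b2 : R).
Hypothesis wn : normal_torsion w c d b1 b2.

Lemma normal_skew_entries :
  (forall i j k, Nform w (delta i) (delta j) (delta k)
     + Nform w (delta j) (delta i) (delta k) = 0) ->
  b1 = c /\ b2 = d.
Proof.
move=> h; have := h 4 0 2; have := h 4 0 3.
rewrite !(Nform_normal ws wn) /sd_form !delta_I5 => h1 h2; split; lra.
Qed.

Lemma normal_gform_skew_entries :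
  (forall i j, gform w (delta i) (delta j) = - 2 * dform w (delta i) (delta j)) ->
  b1 = c /\ b2 = d.
Proof.
move=> h; have := h 0 2; have := h 0 3.
rewrite !(gform_normal ws wn) !(dform_normal ws wn) /sd_form !delta_I5 => h1 h2; split; lra.
Qed.

(** By [Nform_normal] the cyclic sum of N is - 4 (B + 2 C) /\ eta. *)
Lemma normal_cyclic_entries :
  (forall i j k, Nform w (delta i) (delta j) (delta k) + Nform w (delta j) (delta k) (delta i)
     + Nform w (delta k) (delta i) (delta j) = 0) ->
  b1 = - 2 * c /\ b2 = - 2 * d.
Proof.
move=> h; have := h 0 2 4; have := h 0 3 4.
rewrite !(Nform_normal ws wn) /sd_form !delta_I5 => h1 h2; split; lra.
Qed.

Lemma normal_gform_cyclic_entries :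
  (forall i j, gform w (delta i) (delta j) = dform w (delta i) (delta j)) ->
  b1 = - 2 * c /\ b2 = - 2 * d.
Proof.
move=> h; have := h 0 2; have := h 0 3.
rewrite !(gform_normal ws wn) !(dform_normal ws wn) /sd_form !delta_I5 => h1 h2; split; lra.
Qed.

End Normal.

Section W4.
Variables (c d : R).
Hypothesis wn : normal_torsion w c d c d.

Lemma W4_Nform x y z : Nform w x y z =
  2 * (dform w x y * z 4 + dform w y z * x 4 + dform w z x * y 4).
Proof. by rewrite (Nform_normal ws wn) !(dform_normal ws wn) /sd_form; ring. Qed.

Lemma W4_skew x y z : Nform w x y z + Nform w y x z = 0.
Proof. by rewrite !W4_Nform /dform; ring. Qed.

Lemma W4_gform x y : gform w x y = - 2 * dform w x y.
Proof. by rewrite (gform_normal ws wn) (dform_normal ws wn) /sd_form; ring. Qed.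

End W4.

Section W7.
Variables (c d : R).
Hypothesis wn : normal_torsion w c d (- 2 * c) (- 2 * d).

Lemma W7_Nform x y z :
  Nform w x y z = 2 * x 4 * dform w y z + y 4 * dform w x z - z 4 * dform w x y.
Proof. by rewrite (Nform_normal ws wn) !(dform_normal ws wn) /sd_form; ring. Qed.

Lemma W7_cyclic x y z : Nform w x y z + Nform w y z x + Nform w z x y = 0.
Proof. by rewrite !W7_Nform /dform; ring. Qed.

(** Each summand vanishes: the forms B and C are skew, and e_4 lies in their kernel. *)
Lemma W7_traceless x : \sum_i Nform w (delta i) (delta i) x = 0.
Proof. by rewrite sum_I5 !(Nform_normal ws wn) /sd_form !delta_I5; ring. Qed.

Lemma W7_gform x y : gform w x y = dform w x y.
Proof. by rewrite (gform_normal ws wn) (dform_normal ws wn) /sd_form; ring. Qed.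

End W7.
End BasisVectors.

(** * Transfer from vector fields to component vectors *)

Section Components.
Context {R : realType} {M : manifold5 R} (A : acm M).
Notation E := 'rV[R]_5.
Context {nabla : M -> E -> (M -> E) -> E} (lc : levi_civita (acm_g A) nabla).
Variables (p : M) (e : 'I_5 -> M -> E).
Hypothesis adapted : adapted_frame A p e.
Notation w := (conn A nabla p e).
Notation comp := (comp A p e).
Implicit Types (X Y Z : M -> E).

Lemma conn_skew k : Lambda2 (w k).
Proof. exact: connection_skew. Qed.

Lemma comp_phif_fun X : comp (phi_field A X) = phi0 (comp X).
Proof. by apply/funext => i; exact: comp_phif. Qed.

Lemma comp_xi_fun : comp (xi A) = @eta0 R.
Proof. by apply/funext => i; exact: comp_xi. Qed.

Lemma comp_frame_fun i : comp (e i) = basis_vec R i.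
Proof. by apply/funext => j; exact: comp_frame. Qed.

Lemma deta_form X Y : smooth_field p X -> smooth_field p Y ->
  deta A nabla X Y p = dform w (comp X) (comp Y).
Proof. by move=> sX sY; rewrite /deta !(nabla_eta_comp lc adapted). Qed.

Lemma dPhi_form X Y Z : smooth_field p X -> smooth_field p Y -> smooth_field p Z ->
  dPhi A nabla X Y Z p = dPhiform w (comp X) (comp Y) (comp Z).
Proof. by move=> sX sY sZ; rewrite /dPhi !(nabla_Phi_comp lc adapted). Qed.

Lemma Nij_form X Y Z : smooth_field p X -> smooth_field p Y -> smooth_field p Z ->
  Nij A nabla X Y Z p = Nform w (comp X) (comp Y) (comp Z).
Proof.
move=> sX sY sZ; have sX' := smooth_phif A sX.
rewrite (NijE lc)// !(nabla_Phi_comp lc adapted)// !comp_phif_fun deta_form//.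
by rewrite (eta_comp adapted).
Qed.

Lemma gamma_form X Y : smooth_field p X -> smooth_field p Y ->
  gamma A nabla X Y p = gform w (comp X) (comp Y).
Proof.
move=> sX sY; rewrite /gamma dPhi_form//; last exact: smooth_phif.
  by rewrite comp_xi_fun comp_phif_fun.
exact: xi_smooth.
Qed.

End Components.

(** * The classes on the manifold *)

Section Classes.
Context {R : realType} {M : manifold5 R} (A : acm M).
Notation E := 'rV[R]_5.
Context {nabla : M -> E -> (M -> E) -> E} (lc : levi_civita (acm_g A) nabla).
Notation w := (conn A nabla).

Lemma of_classP (W : ('I_5 -> 'I_5 -> 'I_5 -> R) -> Prop) (Q : ('I_5 -> 'M[R]_5) -> Prop) :
  (forall v, (forall k, Lambda2 (v k)) -> W (fun k i j => pr_u2perp (v k) i j) <-> Q v) ->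
  of_class A nabla W <-> forall p e, adapted_frame A p e -> Q (w p e).
Proof.
move=> WQ; split=> h p e ae; have := h p e ae.
  by move/(WQ (w p e) (conn_skew lc ae)).
by move/(WQ (w p e) (conn_skew lc ae)).
Qed.

Let W47P := of_classP (@W4_plus_W7_normal R).
Let W4P := of_classP (@W4_normal R).
Let W7P := of_classP (@W7_normal R).

Lemma generalized_quasi_SasakiP :
  of_class A nabla (@W4_plus_W7 R) <->
   generalized_quasi_Sasaki A nabla /\
   forall p X Y, smooth_field p X -> smooth_field p Y ->
     Nij A nabla (xi A) X Y p = 2 * deta A nabla X Y p.
Proof.
split=> [/W47P h|[[hor /(killingE lc) kil] Nxi]].
  split; first split.
  - move=> p X Y Z sX sY sZ X0 Y0 Z0.
    have [e ae] := exists_adapted_frame A p.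
    have [c [d [b1 [b2 wn]]]] := h p e ae.
    have c4 V : acm_g A p (V p) (xi A p) = 0 -> comp A p e V 4 = 0.
      by rewrite -(eta_comp ae) /eta g_sym.
    rewrite (Nij_form lc ae)// (dPhi_form lc ae)//; split.
      by apply: (normal_Nform_horizontal (conn_skew lc ae) wn); exact: c4.
    by apply: (normal_dPhi_horizontal (conn_skew lc ae) wn); exact: c4.
  - apply/(killingE lc) => p Y Z sY sZ.
    have [e ae] := exists_adapted_frame A p.
    have [c [d [b1 [b2 wn]]]] := h p e ae.
    rewrite !(nabla_eta_comp lc ae)//.
    exact: (normal_killing (conn_skew lc ae) wn).
  move=> p X Y sX sY.
  have [e ae] := exists_adapted_frame A p.
  have [c [d [b1 [b2 wn]]]] := h p e ae.
  rewrite (Nij_form lc ae)//; last exact: xi_smooth.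
  rewrite (deta_form lc ae)// comp_xi_fun//.
  exact: (normal_Nform_xi (conn_skew lc ae) wn).
apply/W47P => p e ae.
have se := smooth_frame ae.
have ce := comp_frame_fun ae.
apply: normal_of_horizontal; first exact: conn_skew.
- move=> i j; have := kil p (e i) (e j) (se i) (se j).
  by rewrite !(nabla_eta_comp lc ae)// !ce.
- move=> i j k i4 j4 k4.
  have c0 l : l != 4 -> acm_g A p (e l p) (xi A p) = 0.
    by move=> /negPf l4; rewrite (xi_frame ae) (frame_orthonormal ae) l4.
  have := hor p (e i) (e j) (e k) (se i) (se j) (se k) (c0 i i4) (c0 j j4) (c0 k k4).
  by rewrite (Nij_form lc ae)// (dPhi_form lc ae)// !ce.
move=> i j; have := Nxi p (e i) (e j) (se i) (se j).
rewrite (Nij_form lc ae)//; last exact: xi_smooth.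
by rewrite (deta_form lc ae)// !ce (comp_xi_fun ae).
Qed.

Section ClassW4W7.
Hypothesis h : of_class A nabla (@W4_plus_W7 R).

Lemma gamma_Nij p X Y : smooth_field p X -> smooth_field p Y ->
  gamma A nabla X Y p = Nij A nabla (phi_field A X) (phi_field A Y) (xi A) p /\
  gamma A nabla X Y p = - gamma A nabla Y X p.
Proof.
move=> sX sY; have [e ae] := exists_adapted_frame A p.
have [c [d [b1 [b2 wn]]]] := W47P.1 h p e ae.
have sk := conn_skew lc ae.
rewrite !(gamma_form lc ae)// (Nij_form lc ae);
  [|exact: smooth_phif|exact: smooth_phif|exact: xi_smooth].
rewrite !(comp_phif_fun ae) (comp_xi_fun ae); split.
  exact: (normal_gform sk wn).
exact: (normal_gform_skew sk wn).
Qed.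

(** Within W4 + W7 every frame supplies some B and C, so a characterization of W4 only has to force
    B = C. *)
Lemma of_class_W4P (P : Prop) :
  (of_class A nabla (@W4 R) -> P) ->
  (P -> forall p e c d b1 b2, adapted_frame A p e -> normal_torsion (w p e) c d b1 b2 ->
     b1 = c /\ b2 = d) ->
  of_class A nabla (@W4 R) <-> P.
Proof.
move=> hP Ph; split=> // /Ph H; apply/W4P => p e ae.
have [c [d [b1 [b2 wn]]]] := W47P.1 h p e ae.
have [e1 e2] := H p e c d b1 b2 ae wn.
by rewrite e1 e2 in wn; exists c, d.
Qed.

Lemma of_class_W7P (P : Prop) :
  (of_class A nabla (@W7 R) -> P) ->
  (P -> forall p e c d b1 b2, adapted_frame A p e -> normal_torsion (w p e) c d b1 b2 ->
     b1 = - 2 * c /\ b2 = - 2 * d) ->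
  of_class A nabla (@W7 R) <-> P.
Proof.
move=> hP Ph; split=> // /Ph H; apply/W7P => p e ae.
have [c [d [b1 [b2 wn]]]] := W47P.1 h p e ae.
by exists c, d; have [<- <-] := H p e c d b1 b2 ae wn.
Qed.

End ClassW4W7.
End Classes.

Theorem theorem4p1 (R : realType) (M : manifold5 R) (A : acm M)
    (nabla : M -> 'rV[R]_5 -> (M -> 'rV[R]_5) -> 'rV[R]_5)
    (nabla_lc : levi_civita (acm_g A) nabla) :
  (of_class A nabla (@W4_plus_W7 R) <->
   generalized_quasi_Sasaki A nabla /\
   forall p X Y, smooth_field p X -> smooth_field p Y ->
     Nij A nabla (xi A) X Y p = 2 * deta A nabla X Y p)
  /\
  (of_class A nabla (@W4_plus_W7 R) ->
   (* the two expressions for gamma agree and gamma is a 2-form *)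
   (forall p X Y, smooth_field p X -> smooth_field p Y ->
      gamma A nabla X Y p
        = Nij A nabla (phi_field A X) (phi_field A Y) (xi A) p /\
      gamma A nabla X Y p = - gamma A nabla Y X p)
   /\
   [/\ of_class A nabla (@W4 R) <-> Nij_totally_skew A nabla,
       of_class A nabla (@W4 R) <->
       (forall p X Y, smooth_field p X -> smooth_field p Y ->
          gamma A nabla X Y p = - 2 * deta A nabla X Y p)
     & of_class A nabla (@W4 R) ->
       forall p X Y Z,
         smooth_field p X -> smooth_field p Y -> smooth_field p Z ->
         Nij A nabla X Y Z p = 2 * deta_wedge_eta A nabla X Y Z p]
   /\
   [/\ of_class A nabla (@W7 R) <-> Nij_traceless_cyclic A nabla,
       of_class A nabla (@W7 R) <->
       (forall p X Y, smooth_field p X -> smooth_field p Y ->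
          gamma A nabla X Y p = deta A nabla X Y p)
     & of_class A nabla (@W7 R) ->
       forall p X Y Z,
         smooth_field p X -> smooth_field p Y -> smooth_field p Z ->
         Nij A nabla X Y Z p
         = 2 * eta A p (X p) * deta A nabla Y Z p
           + eta A p (Y p) * deta A nabla X Z p
           - eta A p (Z p) * deta A nabla X Y p]).
Proof.
have lc := nabla_lc.
have W4n p : of_class A nabla (@W4 R) ->
    exists e, adapted_frame A p e /\ exists c d, normal_torsion (conn A nabla p e) c d c d.
  move=> /(of_classP lc (@W4_normal R)) h4.
  by have [e ae] := exists_adapted_frame A p; exists e; split => //; exact: h4.
(* Unlike for W4, every adapted frame is kept, since tracelessness is a statement about all of
   them. *)
have W7n p : of_class A nabla (@W7 R) ->
    forall e, adapted_frame A p e ->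
    exists c d, normal_torsion (conn A nabla p e) c d (-2 * c) (-2 * d).
  by move=> /(of_classP lc (@W7_normal R)) h7 e ae; exact: h7.
split; first exact: generalized_quasi_SasakiP.
move=> h; split; first by move=> p X Y; exact: gamma_Nij.
split; split.
- apply: (of_class_W4P lc h) => [h4 g p X Y Z sX sY sZ|sk p e c d b1 b2 ae wn].
    have [e [ae [c [d wn]]]] := W4n p h4; rewrite !(Nij_form lc ae)//.
    exact: (W4_skew (conn_skew lc ae) wn).
  apply: (normal_skew_entries (conn_skew lc ae) wn) => i j k.
  have se := smooth_frame ae.
  by have := sk p _ _ _ (se i) (se j) (se k); rewrite !(Nij_form lc ae)// !(comp_frame_fun ae).
- apply: (of_class_W4P lc h) => [h4 p X Y sX sY|ga p e c d b1 b2 ae wn].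
    have [e [ae [c [d wn]]]] := W4n p h4; rewrite (gamma_form lc ae)// (deta_form lc ae)//.
    exact: (W4_gform (conn_skew lc ae) wn).
  apply: (normal_gform_skew_entries (conn_skew lc ae) wn) => i j.
  have se := smooth_frame ae.
  have := ga p _ _ (se i) (se j).
  by rewrite (gamma_form lc ae)// (deta_form lc ae)// !(comp_frame_fun ae).
- move=> h4 p X Y Z sX sY sZ; have [e [ae [c [d wn]]]] := W4n p h4.
  rewrite /deta_wedge_eta (Nij_form lc ae)// !(deta_form lc ae)// !(eta_comp ae).
  exact: (W4_Nform (conn_skew lc ae) wn).
- apply: (of_class_W7P lc h) => [h7|[cy _] p e c d b1 b2 ae wn].
    split=> [p X Y Z sX sY sZ|p e X ae sX].
      have [e ae] := exists_adapted_frame A p; have [c [d wn]] := W7n p h7 e ae.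
      rewrite !(Nij_form lc ae)//.
      exact: (W7_cyclic (conn_skew lc ae) wn).
    have [c [d wn]] := W7n p h7 e ae; have se := smooth_frame ae.
    under eq_bigr do rewrite (Nij_form lc ae)// (comp_frame_fun ae).
    exact: (W7_traceless (conn_skew lc ae) wn).
  apply: (normal_cyclic_entries (conn_skew lc ae) wn) => i j k.
  have se := smooth_frame ae.
  by have := cy p _ _ _ (se i) (se j) (se k); rewrite !(Nij_form lc ae)// !(comp_frame_fun ae).
- apply: (of_class_W7P lc h) => [h7 p X Y sX sY|ga p e c d b1 b2 ae wn].
    have [e ae] := exists_adapted_frame A p; have [c [d wn]] := W7n p h7 e ae.
    rewrite (gamma_form lc ae)// (deta_form lc ae)//.
    exact: (W7_gform (conn_skew lc ae) wn).
  apply: (normal_gform_cyclic_entries (conn_skew lc ae) wn) => i j.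
  have se := smooth_frame ae.
  have := ga p _ _ (se i) (se j).
  by rewrite (gamma_form lc ae)// (deta_form lc ae)// !(comp_frame_fun ae).
move=> h7 p X Y Z sX sY sZ; have [e ae] := exists_adapted_frame A p.
have [c [d wn]] := W7n p h7 e ae.
rewrite (Nij_form lc ae)// !(deta_form lc ae)// !(eta_comp ae).
exact: (W7_Nform (conn_skew lc ae) wn).
Qed.
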